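(* Let $A\subset\mathbb R^n$ be such that $c_*(A)>0$ and $\mathcal E^+(A)$ is strongly closed, and let $\omega$ be a (signed) measure such that either (i) $\omega\in\mathcal E$, or (ii) $\omega^+$ is bounded, $U^\omega$ is upper semicontinuous on $\overline{A}$, and $\sup_{x\in A}U^{|\omega|}(x)<\infty$. Put $f:=-U^\omega$. If $c_*(A)<\infty$, then there exists $\lambda_{A,f}$ minimizing $I_f(\mu)$ over $\mu\in\breve{\mathcal E}^+(A)$.
   Context: Let $n\geqslant2$, $0<\alpha<n$, and $\kappa_\alpha(x,y):=|x-y|^{\alpha-n}$ on $\mathbb R^n$. A measure is a real-valued (signed) Radon measure $\mu$ on $\mathbb R^n$ with Hahn--Jordan decomposition $\mu=\mu^+-\mu^-$ and $|\mu|:=\mu^++\mu^-$; $\mu$ is bounded if $|\mu|(\mathbb R^n)<\infty$. All measures considered are assumed to satisfy $\int_{|y|>1}|y|^{\alpha-n}\,d|\mu|(y)<\infty$. Potential: $U^\mu(x):=\int\kappa_\alpha(x,y)\,d\mu(y)$. Energy: $I(\mu):=\int\kappa_\alpha\,d(\mu\otimes\mu)$. $\mathcal E$ is the pre-Hilbert space of all measures of finite energy, with inner product $\langle\mu,\nu\rangle=\int\kappa_\alpha\,d(\mu\otimes\nu)$ and norm $\|\mu\|=\sqrt{I(\mu)}$; the norm topology is called strong. $\mathcal E^+$ is the cone of positive measures in $\mathcal E$. For $A\subset\mathbb R^n$ (not necessarily Borel), $\mathcal E^+(A)$ is the set of $\mu\in\mathcal E^+$ concentrated on $A$ (i.e.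 $\mathbb R^n\setminus A$ is $\mu$-negligible), and $\overline A$ is the closure of $A$ in $\mathbb R^n$. Inner capacity: $c_*(A):=\sup\{c(K):K\subset A\text{ compact}\}$, where $c(K):=1/\inf\{\|\mu\|^2:\mu\in\mathcal E^+(K),\ \mu(K)=1\}$ (with $\inf\varnothing=\infty$, $1/\infty=0$). $I_f(\mu):=\|\mu\|^2+2\int f\,d\mu=\|\mu\|^2-2\int U^\omega\,d\mu$, and $\breve{\mathcal E}^+(A):=\{\mu\in\mathcal E^+(A):\mu(\mathbb R^n)=1\}$; under the stated assumptions $I_f$ is finite on $\breve{\mathcal E}^+(A)$. *)

(* Defs.v *)
From HB Require Import structures.
From mathcomp Require Import all_boot all_order all_algebra.
From mathcomp Require Import all_classical all_reals all_analysis.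

Set Implicit Arguments.
Unset Strict Implicit.
Unset Printing Implicit Defensive.

Import Order.TTheory GRing.Theory Num.Theory.
Import numFieldNormedType.Exports.

Local Open Scope classical_set_scope.
Local Open Scope ring_scope.

(* R^n with its Borel sigma-algebra; the underlying type is 'rV[R]_n, whose
   library topology is the usual one. *)
Notation borel R n := (g_sigma_algebraType (@open 'rV[R]_n)).

(* The library norm `|x| on 'rV[R]_n is the sup norm. *)
Definition euclid_norm (R : realType) (n : nat) (x : 'rV[R]_n) : R :=
  Num.sqrt (\sum_(i < n) x ord0 i ^+ 2).

(* Since 0 `^ r = 0 for r != 0, the value on the diagonal is set explicitly. *)
Definition riesz_kernel (R : realType) (n : nat) (alpha : R) (x y : 'rV[R]_n) :
    \bar R :=
  if x == y then +oo%E else (euclid_norm (x - y) `^ (alpha - n%:R))%:E.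

(* Real-valued (signed) Radon measures mu on R^n, represented by their
   Hahn-Jordan decomposition mu = spos - sneg; both parts may have infinite
   total mass. A Borel measure on R^n that is finite on compact sets is
   automatically regular and sigma-finite; sigma-finiteness is bundled because
   the library's product measure asks for it. *)
Record smeasure (R : realType) (n : nat) (alpha : R) := SMeasure {
  spos : {sigma_finite_measure set (borel R n) -> \bar R} ;
  sneg : {sigma_finite_measure set (borel R n) -> \bar R} ;
  spos_compact : forall K : set 'rV[R]_n, compact K -> (spos K < +oo)%E ;
  sneg_compact : forall K : set 'rV[R]_n, compact K -> (sneg K < +oo)%E ;
  smeasure_singular : exists H : set (borel R n),
    [/\ measurable H, spos (~` H) = 0%E & sneg H = 0%E] ;
  smeasure_tail :
    (\int[measure_add spos sneg]_(y in [set y | (1 < euclid_norm y)%R])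
       (euclid_norm y `^ (alpha - n%:R))%:E < +oo)%E
}.

Section energy.
Context (R : realType) (n : nat) (alpha : R).
Implicit Types (mu nu omega : smeasure n alpha) (A K : set 'rV[R]_n).
Local Open Scope ereal_scope.

Definition abs_measure mu : {measure set (borel R n) -> \bar R} :=
  measure_add (spos mu) (sneg mu).

(* Meaningful when the two terms are not both infinite, e.g. for bounded B. *)
Definition signed_value mu (B : set 'rV[R]_n) : \bar R := spos mu B - sneg mu B.

(* Meaningful when the two terms are not both infinite; the library's
   convention is +oo - +oo = -oo. *)
Definition integral_signed mu (f : 'rV[R]_n -> \bar R) : \bar R :=
  \int[spos mu]_x f x - \int[sneg mu]_x f x.

Definition potential mu (x : 'rV[R]_n) : \bar R :=
  integral_signed mu (riesz_kernel alpha x).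

Definition abs_potential mu (x : 'rV[R]_n) : \bar R :=
  \int[abs_measure mu]_y riesz_kernel alpha x y.

(* The integral of the kernel against mu \x nu, whose positive and negative
   parts are the first and the second line. *)
Definition mutual_energy mu nu : \bar R :=
  let J (m1 m2 : {sigma_finite_measure set (borel R n) -> \bar R}) :=
    \int[m1 \x m2]_z riesz_kernel alpha z.1 z.2 in
  (J (spos mu) (spos nu) + J (sneg mu) (sneg nu)) -
  (J (spos mu) (sneg nu) + J (sneg mu) (spos nu)).

Definition energy mu : \bar R := mutual_energy mu mu.

(* With +oo - +oo = -oo, this says that the kernel is integrable with respect
   to |mu| \x |mu|. *)
Definition finite_energy mu : Prop := energy mu \is a fin_num.

Definition strong_norm mu : R := Num.sqrt (fine (energy mu)).

(* delta = mu - nu, as signed Radon measures. *)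
Definition is_difference (delta mu nu : smeasure n alpha) : Prop :=
  forall B : set (borel R n), measurable B -> bounded_set (B : set 'rV[R]_n) ->
    signed_value delta B = signed_value mu B - signed_value nu B.

Definition strongly_closed (F : set (smeasure n alpha)) : Prop :=
  forall mu, finite_energy mu ->
  (forall e : R, (0 < e)%R -> exists nu delta,
     [/\ F nu, is_difference delta mu nu, finite_energy delta &
         (strong_norm delta < e)%R]) ->
  F mu.

Definition positive_measure mu : Prop :=
  forall B : set (borel R n), measurable B -> sneg mu B = 0.

Definition Eplus A : set (smeasure n alpha) :=
  [set mu | [/\ finite_energy mu, positive_measure mu &
                (abs_measure mu).-negligible (~` A)]].

Definition Eplus1 A : set (smeasure n alpha) :=
  [set mu | Eplus A mu /\ signed_value mu setT = 1].

(* In \bar R: inverse of +oo is 0, and ereal_inf set0 = +oo. *)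
Definition capacity K : \bar R :=
  (ereal_inf [set energy mu | mu in Eplus1 K])^-1.

Definition inner_capacity A : \bar R :=
  ereal_sup [set capacity K | K in [set K | compact K /\ K `<=` A]].

Definition weighted_energy (f : 'rV[R]_n -> \bar R) mu : \bar R :=
  energy mu + 2%:E * integral_signed mu f.

End energy.

Definition upper_semicontinuous_on (R : realType) (T : topologicalType)
    (D : set T) (f : T -> \bar R) : Prop :=
  forall x, D x -> forall a : R, (f x < a%:E)%E ->
    \forall y \near x, D y -> (f y < a%:E)%E.

(* Main.v *)
From HB Require Import structures.
Require Import Defs.
From mathcomp Require Import all_boot all_order all_algebra.
From mathcomp Require Import all_classical all_reals all_analysis.
From mathcomp Require Import measurable_realfun.
From mathcomp Require Import ring lra.

Set Implicit Arguments.
Unset Strict Implicit.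
Unset Printing Implicit Defensive.

Import Order.TTheory GRing.Theory Num.Theory.
Import numFieldNormedType.Exports.

Local Open Scope classical_set_scope.
Local Open Scope ring_scope.

(** Write [J m1 m2] for the integral of the kernel against [m1 \x m2], and
[L m] for the integral of the potential of [omega] against [m]. On unit
measures carried by [A] the functional to be minimized is [J m m - 2 * L m]
with [L] affine, so the parallelogram law makes every minimizing sequence
Cauchy in the energy norm. What has to be shown is that such a sequence has a
limit which is a unit measure carried by [A], and that [L] does not drop in
the limit.

The positive measures of finite energy form a strongly complete cone although
the space of signed ones need not be complete. The kernel is a superposition
of products, [c * kappa(x, y) = \int H(x, z) H(y, z) d rho(z)] with [H]
nonnegative, continuous and bounded in [x] (lemma [riesz_features]).
Integrating in [x] attaches to a measure its feature
[P_m(z) = \int H(x, z) dm(x)], and [c * J] is the inner product of features in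
L^2([rho]). A sequence that is Cauchy in energy at a geometric rate has
features converging in L^2 and almost everywhere; if it also has a weak
cluster point, weak convergence identifies the limit of the features, so the
sequence converges strongly to that cluster point ([strong_limit_features]).
Positivity enters here, through the weak compactness of unit measures.

No mass is lost at infinity because [A] has finite inner capacity. Were a
fixed amount of mass to escape along measures of bounded energy, then adding
up [N] pieces placed very far from each other would produce mass of order [N]
with energy of order [N], up to a small multiple of [N ^ 2], while finite
capacity forces the squared mass to be at most a constant times the energy
([uniformly_tight]). Tightness gives a weak cluster point of mass one
([weak_cluster_exists]), and strong closedness of the cone of measures carried
by [A] puts it on [A] ([cauchy_limit]).

It remains to pass to the limit in [L]. If [omega] has finite energy, [L] is
strongly continuous by the Cauchy-Schwarz inequality
([field_work_continuous]). If the potential of [omega] is bounded on [A] and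
upper semicontinuous on its closure, [L] is the integral of a bounded function
which can be extended to the whole space as an upper semicontinuous one, and
such integrals do not drop under weak convergence ([field_work_usc]). *)

(** * Gaussian integrals on the real line *)

Section real_line.
Context {R : realType}.
Notation leb := (@lebesgue_measure R).
Local Open Scope ereal_scope.

Lemma integral_translation (G : R -> R) (a : R) :
  continuous G -> (forall x, 0 <= G x)%R ->
  \int[leb]_x (G (x + a)%R)%:E = \int[leb]_x (G x)%:E.
Proof.
move=> cG G0.
have D1 : derive1 (fun x : R => (x + a)%R) = cst 1%R.
  by apply/funext => z; rewrite derive1E deriveD ?derive_id ?derive_cst ?addr0.
rewrite [RHS](@increasing_ge0_integration_by_substitutionT _ (fun x => (x + a)%R))//.
- by apply: eq_integral => x _; rewrite fctE D1 mulr1.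
- by move=> x y xy; rewrite ltrD2r.
- by rewrite D1; exact: cst_continuous.
- by rewrite D1; exact: is_cvg_cst.
- by rewrite D1; exact: is_cvg_cst.
- exact: cvg_addrr_Ny.
- exact: cvg_addrr.
Qed.

(** Positivity of the normalizing constants below. *)
Lemma integral_gt0_unit_itv (f : R -> R) (c : R) :
  measurable_fun setT f -> (forall x, 0 <= f x)%R -> (0 < c)%R ->
  (forall x, 0 <= x <= 1 -> c <= f x)%R -> 0 < \int[leb]_x (f x)%:E.
Proof.
move=> mf f0 c0 cf.
have mI : measurable (`[0%R, 1%R]%classic : set R) by [].
apply: (@lt_le_trans _ _ (\int[leb]_(x in `[0%R, 1%R]%classic) c%:E)).
  by rewrite integral_cst//= lebesgue_measure_itv/= lte_fin ltr01 oppr0 adde0 mule1 lte_fin.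
apply: (@le_trans _ _ (\int[leb]_(x in `[0%R, 1%R]%classic) (f x)%:E)).
  apply: ge0_le_integral => //.
  - by move=> x _; rewrite lee_fin ltW.
  - exact/measurable_EFinP/measurable_funTS.
apply: ge0_subset_integral => //; first exact/measurable_EFinP.
by move=> x _; rewrite lee_fin.
Qed.

Lemma continuous_expR_comp (f : R -> R) : continuous f -> continuous (expR \o f).
Proof. by move=> cf x; apply: continuous_comp; [exact: cf|exact: continuous_expR]. Qed.

Definition gaussbump (s z : R) : R := expR (- (s - z) ^+ 2).

Lemma gaussbump_ge0 s z : (0 <= gaussbump s z)%R. Proof. exact: expR_ge0. Qed.

Lemma gaussbump_le1 s z : (gaussbump s z <= 1)%R.
Proof. by rewrite /gaussbump -expR0 ler_expR oppr_le0 sqr_ge0. Qed.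

Lemma gauss_finite_pos : exists2 c : R, (0 < c)%R &
  \int[leb]_z (expR (- (z ^+ 2 *+ 2)))%:E = c%:E.
Proof.
have cf : continuous (fun z : R => expR (- (z ^+ 2 *+ 2))).
  apply: continuous_expR_comp => x; apply: cvgN; apply: cvgMn.
  exact: exprn_continuous.
have mf := continuous_measurable_fun cf.
set I := \int[leb]_z _.
have I0 : 0 < I.
  apply: (@integral_gt0_unit_itv _ (expR (-2))); rewrite ?expR_gt0//.
  by move=> x /andP[x0 x1]; rewrite ler_expR; nra.
have Ioo : I < +oo.
  apply: (@le_lt_trans _ _ (\int[leb]_z (gauss_fun z)%:E)); last first.
    by rewrite integralT_gauss ltry.
  apply: ge0_le_integral => //.
  - exact/measurable_EFinP.
  - by apply/measurable_EFinP; exact: measurable_gauss_fun.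
  - by move=> x _; rewrite lee_fin ler_expR; have := sqr_ge0 x; nra.
exists (fine I); first by rewrite fine_gt0// I0.
by rewrite fineK// ge0_fin_numE// ltW.
Qed.

(** The convolution of two Gaussians is a Gaussian of the distance of their
centres: completing the square separates the integration variable from
[s - t], and translation invariance removes it. *)
Lemma integral_gaussbump : exists2 c : R, (0 < c)%R & forall s t : R,
  \int[leb]_z (gaussbump s z * gaussbump t z)%:E = (c * expR (- (s - t) ^+ 2 / 2))%:E.
Proof.
have [c c0 cE] := gauss_finite_pos; exists c => // s t.
have cf : continuous (fun z : R => expR (- (z ^+ 2 *+ 2))).
  apply: continuous_expR_comp => x; apply: cvgN; apply: cvgMn.
  exact: exprn_continuous.
have H z : (gaussbump s z * gaussbump t z)%R =
  (expR (- (s - t) ^+ 2 / 2) * expR (- ((z - (s + t) / 2) ^+ 2 *+ 2)))%R.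
  by rewrite -!expRD; congr expR; field.
under eq_integral do rewrite H EFinM.
rewrite ge0_integralZl_EFin//; last first.
  apply/measurable_EFinP; apply: (measurableT_comp (continuous_measurable_fun cf)).
  exact: measurable_funB.
by rewrite (integral_translation (- ((s + t) / 2)) cf) ?cE 1?EFinM 1?muleC// => ?; exact: expR_ge0.
Qed.

(** In the variable [v], the integrand of the subordination formula that
writes [D `^ (- s)] as a superposition of Gaussians in [D]; the substitution
by [expR v] makes a scaling of [D] act by translation. *)
Definition radial (s D v : R) : R := expR (s * v - expR (v *+ 2) * D ^+ 2 / 2).

Lemma radial_continuous s D : continuous (radial s D).
Proof.
apply: continuous_expR_comp => v; apply: cvgB.
  by apply: cvgM; [exact: cvg_cst|exact: cvg_id].
apply: cvgM; last exact: cvg_cst.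
apply: cvgM; last exact: cvg_cst.
by apply: (@continuous_expR_comp (fun v : R => v *+ 2)%R) => {}v; apply: cvgMn; exact: cvg_id.
Qed.

Lemma integral_exp_abs_fin (s : R) : (0 < s)%R ->
  \int[leb]_v (expR (- (s * `|v|)))%:E < +oo.
Proof.
move=> s0.
rewrite ge0_symfun_integralT; last 3 first.
- by move=> x; exact: expR_ge0.
- apply: continuous_expR_comp => x; apply: cvgN; apply: cvgM; first exact: cvg_cst.
  exact: norm_continuous.
- by move=> x /=; rewrite normrN.
apply: lte_mul_pinfty => //.
rewrite -set_itvcy.
rewrite (_ : integral _ _ _ = \int[leb]_(x in `[0%R, +oo[) ((s^-1)%:E * (exponential_pdf s x)%:E)).
  rewrite ge0_integralZl_EFin//; last 3 first.
  - by move=> x _; rewrite lee_fin exponential_pdf_ge0// ltW.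
  - by apply/measurable_EFinP/measurable_funTS; exact: measurable_exponential_pdf.
  - by rewrite invr_ge0 ltW.
  apply: lte_mul_pinfty => //; first by rewrite lee_fin invr_ge0 ltW.
  apply: (@le_lt_trans _ _ (\int[leb]_x (exponential_pdf s x)%:E)); last first.
    by rewrite integral_exponential_pdf// ltry.
  apply: ge0_subset_integral => //.
    by apply/measurable_EFinP; exact: measurable_exponential_pdf.
  by move=> x _; rewrite lee_fin exponential_pdf_ge0// ltW.
apply: eq_integral => x; rewrite inE/= in_itv/= andbT => x0.
rewrite exponential_pdfE// -EFinM mulrA mulVf ?gt_eqF// mul1r.
by rewrite ger0_norm// mulNr.
Qed.

Lemma radial1_finite_pos (s : R) : (0 < s)%R -> exists2 c : R, (0 < c)%R &
  \int[leb]_v (radial s 1 v)%:E = c%:E.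
Proof.
move=> s0; have mf := continuous_measurable_fun (@radial_continuous s 1).
set I := \int[leb]_z _.
have I0 : 0 < I.
  apply: (@integral_gt0_unit_itv _ (expR (- expR 2 / 2))); rewrite ?expR_gt0//.
    by move=> x; exact: expR_ge0.
  move=> x /andP[x0 x1]; rewrite ler_expR expr1n mulr1.
  have : (expR (x *+ 2) <= expR 2)%R by rewrite ler_expR; lra.
  by have := mulr_ge0 (ltW s0) x0; lra.
have mexp : measurable_fun setT (fun v : R => expR (- (s * `|v|))).
  apply: measurableT_comp => //; apply: measurableT_comp => //.
  by apply: measurable_funM => //; exact: measurableT_comp.
have Ioo : I < +oo.
  apply: (@le_lt_trans _ _ (\int[leb]_v (expR (s ^+ 2 *+ 2) * expR (- (s * `|v|)))%:E)).
    apply: ge0_le_integral => //.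
    - by move=> x _; rewrite lee_fin expR_ge0.
    - exact/measurable_EFinP.
    - by apply/measurable_EFinP; apply: measurable_funM.
    (* the exponents satisfy [s * v - expR (v *+ 2) / 2 <= 2 * s ^+ 2 - s * `|v|] *)
    - move=> x _; rewrite lee_fin -expRD ler_expR.
      have E2 : expR (x *+ 2) = (expR x ^+ 2)%R by rewrite mulr2n expRD.
      rewrite E2; have := expR_ge1Dx x; have := expR_gt0 x.
      have [x0|x0] := ger0P x => eg e1.
        have : (x ^+ 2 <= expR x ^+ 2)%R by rewrite lerXn2r// ?nnegrE ?ltW//; lra.
        have := sqr_ge0 (x - s *+ 2); nra.
      have := sqr_ge0 (expR x); have := sqr_ge0 s; nra.
  under eq_integral do rewrite EFinM.
  rewrite ge0_integralZl_EFin//; last exact/measurable_EFinP.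
  by apply: lte_mul_pinfty; rewrite ?lee_fin ?expR_ge0//; exact: integral_exp_abs_fin.
exists (fine I); first by rewrite fine_gt0// I0.
by rewrite fineK// ge0_fin_numE// ltW.
Qed.

(** Replacing [v] by [v - ln D] turns [radial s D] into [D `^ (- s)] times
[radial s 1], so a power of the distance comes out of translation invariance
alone. For [D = 0] the integrand is at least one on the half-line, hence the
infinite value, as for the kernel on the diagonal. *)
Lemma integral_radial (s : R) : (0 < s)%R -> exists2 c : R, (0 < c)%R &
  forall D : R, (0 <= D)%R -> \int[leb]_v (radial s D v)%:E =
    c%:E * (if D == 0%R then +oo else (D `^ (- s))%:E).
Proof.
move=> s0; have [c c0 cE] := radial1_finite_pos s0; exists c => // D D0.
have mr := continuous_measurable_fun (@radial_continuous s 0).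
have [->|DN0] := eqVneq D 0%R.
  rewrite gt0_muley ?lte_fin//.
  apply/eqP; rewrite eq_le leey/=.
  apply: (@le_trans _ _ (\int[leb]_(v in `[0%R, +oo[) (cst 1 v))).
    by rewrite integral_cst//= mul1e lebesgue_measure_itv/= ltry.
  apply: (@le_trans _ _ (\int[leb]_(v in `[0%R, +oo[) (radial s 0 v)%:E)).
    apply: ge0_le_integral => //.
    - exact/measurable_EFinP/measurable_funTS.
    - move=> x /=; rewrite in_itv/= andbT => x0; rewrite lee_fin /radial.
      by rewrite expr0n/= mulr0 mul0r subr0 -expR0 ler_expR mulr_ge0// ltW.
  apply: ge0_subset_integral => //.
    exact/measurable_EFinP.
  by move=> x _; rewrite lee_fin expR_ge0.
have Dp : (0 < D)%R by rewrite lt_def DN0.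
have H v : radial s D v = (D `^ (- s) * radial s 1 (v + ln D))%R.
  rewrite /radial /powR (negbTE DN0) -expRD; congr expR.
  have -> : expR ((v + ln D) *+ 2) = (expR (v *+ 2) * D ^+ 2)%R.
    by rewrite mulrnDl expRD; congr (_ * _)%R; rewrite mulr2n expRD lnK ?posrE// expr2.
  by field.
under eq_integral do rewrite H EFinM.
rewrite ge0_integralZl_EFin ?powR_ge0//; last 2 first.
- by move=> x _; rewrite lee_fin expR_ge0.
- apply/measurable_EFinP; apply: (measurableT_comp (continuous_measurable_fun (@radial_continuous s 1))).
  exact: measurable_funD.
rewrite (integral_translation (ln D) (@radial_continuous s 1)) ?cE 1?muleC// => ?; exact: expR_ge0.
Qed.

End real_line.

(** * Factorization of the Riesz kernel *)

Section sigma_finite_product.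
Context d1 d2 (T1 : measurableType d1) (T2 : measurableType d2) (R : realType).
Variables (m1 : {sigma_finite_measure set T1 -> \bar R})
  (m2 : {sigma_finite_measure set T2 -> \bar R}).
Local Open Scope ereal_scope.

(** The product measure under a name that carries a sigma-finite structure, so
that Fubini applies to products of products. *)
Definition sfprod : set (T1 * T2) -> \bar R := (m1 \x m2).

HB.instance Definition _ := Measure.on sfprod.

Let sfprod_sigma_finite : sigma_finite setT sfprod.
Proof.
have /sigma_finiteP[F [TF ndF Foo]] := sigma_finiteT m1.
have /sigma_finiteP[G [TG ndG Goo]] := sigma_finiteT m2.
exists (fun n => F n `*` G n).
  apply/seteqP; split => [[x y] _|//].
  have [i _ Fi] : (\bigcup_i F i) x by rewrite -TF.
  have [j _ Gj] : (\bigcup_i G i) y by rewrite -TG.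
  exists (maxn i j) => //; split.
    by move: Fi; apply/subsetPset/ndF/leq_maxl.
  by move: Gj; apply/subsetPset/ndG/leq_maxr.
move=> k; have [mF Fk] := Foo k; have [mG Gk] := Goo k.
split; first exact: measurableX.
by rewrite /sfprod product_measure1E// lte_mul_pinfty// ge0_fin_numE.
Qed.

HB.instance Definition _ := Measure_isSigmaFinite.Build _ _ _ sfprod sfprod_sigma_finite.

End sigma_finite_product.

Lemma measurable_sqrt (R : realType) : measurable_fun setT (@Num.sqrt R).
Proof. by apply: continuous_measurable_fun; exact: sqrt_continuous. Qed.

Section borel_space.
Context {R : realType} {n : nat}.
Notation X := (borel R n).

Lemma open_borel (O : set 'rV[R]_n) : open O -> measurable (O : set X).
Proof. by move=> oO; exact: sub_sigma_algebra. Qed.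

Lemma closed_borel (F : set 'rV[R]_n) : closed F -> measurable (F : set X).
Proof. by move=> cF; rewrite -[F]setCK; apply: measurableC; apply: open_borel; exact: closed_openC. Qed.

Lemma lsc_borel (f : 'rV[R]_n -> R) :
  (forall a, open [set x | a < f x]) -> measurable_fun setT (f : X -> R).
Proof.
move=> f_open; apply: (measurability _ (RGenOInfty.measurableE R)) => _ [_ [a ->] <-].
rewrite setTI; apply: open_borel; rewrite (_ : _ @^-1` _ = [set x | a < f x]) //.
by apply/seteqP; split => x /=; rewrite in_itv/= andbT.
Qed.

Lemma continuous_borel (f : 'rV[R]_n -> R) :
  continuous f -> measurable_fun setT (f : X -> R).
Proof.
move=> cf; apply: lsc_borel => a.
rewrite (_ : [set _ | _] = f @^-1` [set y | a < y]) //.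
by apply: open_comp; [move=> x _; exact: cf|exact: open_gt].
Qed.

Lemma coord_borel (i : 'I_n) : measurable_fun setT (fun x : X => (x : 'rV[R]_n) ord0 i).
Proof. by apply: continuous_borel; exact: coord_continuous. Qed.

Lemma euclid_norm_ge0 (x : 'rV[R]_n) : 0 <= euclid_norm x.
Proof. exact: sqrtr_ge0. Qed.

Lemma euclid_norm_sqr (x : 'rV[R]_n) : euclid_norm x ^+ 2 = \sum_(i < n) x ord0 i ^+ 2.
Proof. by rewrite sqr_sqrtr// sumr_ge0// => i _; exact: sqr_ge0. Qed.

Lemma euclid_norm_eq0 (x : 'rV[R]_n) : (euclid_norm x == 0) = (x == 0).
Proof.
apply/eqP/eqP => [x0|->]; last first.
  by rewrite /euclid_norm big1 ?sqrtr0// => i _; rewrite mxE expr0n.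
have := euclid_norm_sqr x; rewrite x0 expr0n/= => /esym/eqP.
rewrite psumr_eq0 => [/allP H|i _]; last exact: sqr_ge0.
apply/rowP => i; rewrite mxE; apply/eqP.
by rewrite -sqrf_eq0; apply: H; exact: mem_index_enum.
Qed.

Lemma coord_le_euclid (x : 'rV[R]_n) i : `|x ord0 i| <= euclid_norm x.
Proof.
rewrite -(@ler_pXn2r _ 2)// ?nnegrE ?euclid_norm_ge0// euclid_norm_sqr real_normK ?num_real//.
by rewrite (bigD1 i)//= lerDl sumr_ge0// => j _; exact: sqr_ge0.
Qed.

Lemma norm_le_euclid (x : 'rV[R]_n) : `|x| <= euclid_norm x.
Proof.
rewrite [`|x|]mx_normrE; apply: (big_ind (fun z => z <= euclid_norm x)) => [|a b|[i j] _ /=].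
- exact: euclid_norm_ge0.
- by move=> ha hb; rewrite ge_max ha.
- by rewrite ord1; exact: coord_le_euclid.
Qed.

Lemma euclid_norm_borel : measurable_fun setT (fun x : X => euclid_norm (x : 'rV[R]_n)).
Proof.
apply: (measurableT_comp (@measurable_sqrt R)).
apply: measurable_sum => i.
by apply: measurable_funX; exact: coord_borel.
Qed.

Lemma euclid_dist_borel :
  measurable_fun setT (fun z : X * X => euclid_norm ((z.1 : 'rV[R]_n) - z.2)).
Proof.
apply: (measurableT_comp (@measurable_sqrt R)).
apply: measurable_sum => i.
apply: measurable_funX.
rewrite (_ : (fun _ => _) = (fun z : X * X => (z.1 : 'rV[R]_n) ord0 i - (z.2 : 'rV[R]_n) ord0 i)).
  by apply: measurable_funB; [exact: (measurableT_comp (coord_borel i) measurable_fst)|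
    exact: (measurableT_comp (coord_borel i) measurable_snd)].
by apply/funext => z; rewrite !mxE.
Qed.

Lemma riesz_kernelE alpha (x y : 'rV[R]_n) : riesz_kernel alpha x y =
  (if euclid_norm (x - y) == 0%R then +oo else (euclid_norm (x - y) `^ (alpha - n%:R))%:E)%E.
Proof. by rewrite /riesz_kernel euclid_norm_eq0 subr_eq0. Qed.

Lemma riesz_kernel_ge0 alpha (x y : 'rV[R]_n) : (0 <= riesz_kernel alpha x y)%E.
Proof. by rewrite /riesz_kernel; case: ifP => // _; rewrite lee_fin powR_ge0. Qed.

Lemma riesz_kernel_sym alpha (x y : 'rV[R]_n) : riesz_kernel alpha x y = riesz_kernel alpha y x.
Proof.
rewrite /riesz_kernel eq_sym; congr (if _ then _ else (_ `^ _)%:E).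
by congr Num.sqrt; apply: eq_bigr => i _; rewrite !mxE -sqrrN opprB.
Qed.

Lemma riesz_kernel_borel alpha :
  measurable_fun setT (fun z : X * X => riesz_kernel alpha z.1 z.2).
Proof.
rewrite (_ : (fun _ => _) = (fun r : R => if r == 0 then +oo%E else (r `^ (alpha - n%:R))%:E)
   \o (fun z : X * X => euclid_norm ((z.1 : 'rV[R]_n) - z.2))); last first.
  by apply/funext => z; rewrite riesz_kernelE.
apply: measurableT_comp; last exact: euclid_dist_borel.
apply: measurable_fun_ifT => //.
- by apply: measurable_fun_eqr.
- by apply/measurable_EFinP; exact: measurable_powR.
Qed.

End borel_space.

Section features.
Context {R : realType} {n : nat}.
Notation X := (borel R n).
Notation leb := (@lebesgue_measure R).

Lemma gaussbump_continuous (t : R) : continuous (gaussbump^~ t).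
Proof.
apply: continuous_expR_comp => x; apply: cvgN.
apply: (cvg_comp (fun x => x - t) (fun z => z ^+ 2)); last exact: exprn_continuous.
by apply: cvgB; [exact: cvg_id|exact: cvg_cst].
Qed.

Lemma gaussbump_measurable : measurable_fun setT (fun p : R * R => gaussbump p.1 p.2).
Proof.
apply: measurableT_comp => //; apply: measurableT_comp => //.
by apply: measurable_funX; exact: measurable_funB.
Qed.

(** A Gaussian of the Euclidean distance is the product over the coordinates
of one-dimensional Gaussians, each of which is an inner product of bumps; the
parameter spaces multiply accordingly. The scale [expR v] is kept as a free
parameter, to be integrated out afterwards, and the coordinates are added one
at a time so that only binary products of measure spaces occur. *)
Lemma gaussian_features (s : seq 'I_n) : exists (c : R) d (Z : measurableType d)
    (rho : {sigma_finite_measure set Z -> \bar R}) (h : 'rV[R]_n -> R * Z -> R),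
  [/\ 0 < c, measurable_fun setT (fun p : X * (R * Z) => h p.1 p.2),
      forall w, continuous (h^~ w), forall x w, 0 <= h x w <= 1 &
      forall x y v, (\int[rho]_z (h x (v, z) * h y (v, z))%:E =
       (c * expR (- (expR (v *+ 2) * (\sum_(i <- s) (x ord0 i - y ord0 i) ^+ 2) / 2)))%:E)%E].
Proof.
elim: s => [|i s [c [d [Z [rho [h [c0 mh ch h01 hE]]]]]]].
  (* no coordinate: any probability space serves as parameter space *)
  exists 1, _, R, (\d_ (0 : R)), (fun _ _ => 1); split => //.
  - by move=> w; exact: cst_continuous.
  - by move=> x w; rewrite ler01 lexx.
  - by move=> x y v; rewrite integral_cst// big_nil mulr0 mul0r oppr0 expR0 mul1r/= diracT mule1.
have [c' c'0 bE] := @integral_gaussbump R.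
exists (c * c'), _, (Z * measurableTypeR R)%type, (sfprod rho leb),
  (fun x w => h x (w.1, w.2.1) * gaussbump (expR w.1 * x ord0 i) w.2.2).
have mh' : measurable_fun setT
   (fun p : X * (R * (Z * R)) => h p.1 (p.2.1, p.2.2.1) * gaussbump (expR p.2.1 * (p.1 : 'rV[R]_n) ord0 i) p.2.2.2).
  apply: measurable_funM.
    have mg : measurable_fun setT (fun p : X * (R * (Z * R)) => (p.1, (p.2.1, p.2.2.1))).
      apply: measurable_fun_pair => //.
      apply: measurable_fun_pair; first exact: (measurableT_comp measurable_fst measurable_snd).
      apply: (measurableT_comp measurable_fst).
      exact: (measurableT_comp measurable_snd measurable_snd).
    exact: (measurableT_comp mh mg).
  have mg : measurable_fun setT
      (fun p : X * (R * (Z * R)) => (expR p.2.1 * (p.1 : 'rV[R]_n) ord0 i, p.2.2.2)).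
    apply: measurable_fun_pair.
      apply: measurable_funM.
        by apply: measurableT_comp => //; exact: (measurableT_comp measurable_fst measurable_snd).
      exact: (measurableT_comp (coord_borel i) measurable_fst).
    apply: (measurableT_comp measurable_snd).
    exact: (measurableT_comp measurable_snd measurable_snd).
  exact: (measurableT_comp gaussbump_measurable mg).
have h0 x w : 0 <= h x w by have /andP[] := h01 x w.
split.
- exact: mulr_gt0.
- exact: mh'.
- move=> w x; apply: (@continuousM _ _ (h^~ (w.1, w.2.1))
    (fun y : 'rV[R]_n => gaussbump (expR w.1 * y ord0 i) w.2.2)); first exact: ch.
  apply: (cvg_comp (fun y : 'rV[R]_n => expR w.1 * y ord0 i) (gaussbump^~ w.2.2)).
    by apply: (@continuousM _ _ (cst (expR w.1)) (fun y : 'rV[R]_n => y ord0 i));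
      [exact: cst_continuous|exact: coord_continuous].
  exact: gaussbump_continuous.
- move=> x w; have /andP[h1 h2] := h01 x (w.1, w.2.1).
  by rewrite mulr_ge0 ?gaussbump_ge0//= mulr_ile1 ?gaussbump_ge0 ?gaussbump_le1.
move=> x y v.
have msec a : measurable_fun setT
    (fun p : Z * R => h a (v, p.1) * gaussbump (expR v * a ord0 i) p.2).
  have mg : measurable_fun setT (fun p : Z * R => ((a, (v, p)) : X * (R * (Z * R)))).
    by apply: measurable_fun_pair => //; exact: measurable_fun_pair.
  exact: (measurableT_comp mh' mg).
rewrite [LHS]fubini_tonelli1; last 2 first.
- by apply/measurable_EFinP; apply: measurable_funM; exact: msec.
- by move=> z; rewrite lee_fin !mulr_ge0 ?gaussbump_ge0.
rewrite /fubini_F /=.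
pose e := expR (- (expR v * x ord0 i - expR v * y ord0 i) ^+ 2 / 2).
transitivity (\int[rho]_z ((c' * e)%:E * (h x (v, z) * h y (v, z))%:E))%E.
  apply: eq_integral => z _.
  under eq_integral do rewrite mulrACA EFinM.
  rewrite ge0_integralZl_EFin ?mulr_ge0//; last 2 first.
  - by move=> t _; rewrite lee_fin mulr_ge0 ?gaussbump_ge0.
  - have mb (a : R) : measurable_fun setT (gaussbump a).
      have mg : measurable_fun setT (fun t : R => (a, t)) by exact: measurable_fun_pair.
      exact: (measurableT_comp gaussbump_measurable mg).
    by apply/measurable_EFinP; apply: measurable_funM; exact: mb.
  by rewrite bE muleC.
rewrite ge0_integralZl_EFin//; last 3 first.
- by move=> z _; rewrite lee_fin mulr_ge0.
- have mz a : measurable_fun setT (fun z : Z => h a (v, z)).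
    have mg : measurable_fun setT (fun z : Z => ((a, (v, z)) : X * (R * Z))).
      by apply: measurable_fun_pair => //; exact: measurable_fun_pair.
    exact: (measurableT_comp mh mg).
  by apply/measurable_EFinP; exact: measurable_funM.
- by rewrite mulr_ge0 ?expR_ge0// ltW.
rewrite hE -EFinM; congr EFin.
rewrite mulrACA [c' * c]mulrC; congr (_ * _).
rewrite /e -expRD; congr expR.
by rewrite big_cons mulr2n expRD; field.
Qed.

(** Integrating the Gaussians of [gaussian_features] over their scale with the
weight of [radial] yields the kernel. The half in the exponent is there
because the weight occurs once in each of the two factors. *)
Lemma riesz_features (alpha : R) : alpha < n%:R ->
  exists (c : R) d (Z : measurableType d)
    (rho : {sigma_finite_measure set Z -> \bar R}) (H : 'rV[R]_n -> Z -> R),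
  [/\ 0 < c, measurable_fun setT (fun p : X * Z => H p.1 p.2),
      forall z, continuous (H^~ z), forall z, exists B, forall x, 0 <= H x z <= B &
      forall x y, (\int[rho]_z (H x z * H y z)%:E = c%:E * riesz_kernel alpha x y)%E].
Proof.
move=> an; have s0 : 0 < n%:R - alpha by rewrite subr_gt0.
have [c' c'0 rE] := integral_radial s0.
have [c [d [Z [rho [h [c0 mh ch h01 hE]]]]]] := gaussian_features (index_enum 'I_n).
exists (c * c'), _, (measurableTypeR R * Z)%type, (sfprod leb rho), (fun x w => expR ((n%:R - alpha) * w.1 / 2) * h x w).
have h0 x w : 0 <= h x w by have /andP[] := h01 x w.
have mH : measurable_fun setT (fun p : X * (R * Z) => expR ((n%:R - alpha) * p.2.1 / 2) * h p.1 p.2).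
  apply: measurable_funM => //; apply: measurableT_comp => //.
  apply: measurable_funM => //; apply: measurable_funM => //.
  exact: (measurableT_comp measurable_fst measurable_snd).
split.
- exact: mulr_gt0.
- exact: mH.
- by move=> w x; apply: (@continuousM _ _ (cst _) (h^~ w)); [exact: cst_continuous|exact: ch].
- move=> w; exists (expR ((n%:R - alpha) * w.1 / 2)) => x; have /andP[h1 h2] := h01 x w.
  by rewrite mulr_ge0 ?expR_ge0//= ler_piMr ?expR_ge0.
move=> x y.
have msec a : measurable_fun setT
    (fun p : R * Z => expR ((n%:R - alpha) * p.1 / 2) * h a p).
  have mg : measurable_fun setT (fun p : R * Z => ((a, p) : X * (R * Z))).
    exact: measurable_fun_pair.
  exact: (measurableT_comp mH mg).
rewrite [LHS]fubini_tonelli1; last 2 first.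
- by apply/measurable_EFinP; apply: measurable_funM; exact: msec.
- by move=> z; rewrite lee_fin !mulr_ge0 ?expR_ge0.
rewrite /fubini_F /=.
transitivity (\int[leb]_v (c%:E * (radial (n%:R - alpha) (euclid_norm (x - y)) v)%:E))%E.
  apply: eq_integral => v _.
  under eq_integral do rewrite mulrACA EFinM.
  rewrite ge0_integralZl_EFin ?mulr_ge0 ?expR_ge0//; last 2 first.
  - by move=> t _; rewrite lee_fin mulr_ge0.
  - have mz a : measurable_fun setT (fun z : Z => h a (v, z)).
      have mg : measurable_fun setT (fun z : Z => ((a, (v, z)) : X * (R * Z))).
        by apply: measurable_fun_pair => //; exact: measurable_fun_pair.
      exact: (measurableT_comp mh mg).
    by apply/measurable_EFinP; exact: measurable_funM.
  rewrite hE -!EFinM; congr EFin; rewrite mulrCA; congr (_ * _).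
  rewrite /radial -!expRD; congr expR; rewrite euclid_norm_sqr.
  under [in RHS]eq_bigr do rewrite !mxE.
  by field.
rewrite ge0_integralZl_EFin//; last 3 first.
- by move=> v _; rewrite lee_fin expR_ge0.
- apply/measurable_EFinP.
  exact: (continuous_measurable_fun (@radial_continuous _ (n%:R - alpha) (euclid_norm (x - y)))).
- exact: ltW.
by rewrite rE ?euclid_norm_ge0// riesz_kernelE opprB EFinM muleA.
Qed.

End features.

(** * The energy form and its positive definiteness *)

Section nonneg_ereal.
Context {R : realType}.
Implicit Types a b c : \bar R.
Local Open Scope ereal_scope.

Lemma ereal_amgm a b : 0 <= a -> 0 <= b -> 2%:E * (a * b) <= a * a + b * b.
Proof.
case: a b => [a| |] [b| |]//= a0 b0; rewrite ?mulyy ?addye ?addey ?leey//.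
rewrite -!EFinM -EFinD lee_fin; have := sqr_ge0 (a - b); nra.
Qed.

(** The square of [a + t * c - b] is nonnegative; with extended reals the
negative terms have to stand on the other side. *)
Lemma ereal_three_term a b c (t : R) : (0 < t)%R -> 0 <= a -> 0 <= b -> 0 <= c ->
  2%:E * (a * b) + (2 * t)%:E * (c * b) <=
  a * a + (2 * t)%:E * (a * c) + (t ^+ 2)%:E * (c * c) + b * b.
Proof.
move=> t0; have t20 : (0 < t ^+ 2)%R by rewrite exprn_gt0.
have rhs (x y z u : \bar R) : 0 <= x -> 0 <= y -> 0 <= z -> 0 <= u ->
    (x == +oo) || (z == +oo) || (u == +oo) -> x + y + z + u = +oo.
  by case: x => [x| |]; case: y => [y| |]; case: z => [z| |]; case: u => [u| |].
move=> a0 b0 c0; have tp0 : 0 <= (2 * t)%:E by rewrite lee_fin mulr_ge0// ltW.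
have [|] := boolP ((a == +oo) || (c == +oo) || (b == +oo)).
  move=> h; rewrite rhs ?leey ?mule_ge0// ?lee_fin ?ltW//.
  by move: h => /orP[/orP[]|] /eqP ->; rewrite ?mulyy ?gt0_muley ?lte_fin// eqxx ?orbT.
case: a b c a0 b0 c0 => [a| |] [b| |] [c| |]//= a0 b0 c0 _.
by rewrite -!EFinM -!EFinD lee_fin; have := sqr_ge0 (a + t * c - b); nra.
Qed.

End nonneg_ereal.

(** The potential of a positive measure. This definition and the next two are
locked to keep conversion from unfolding integrals against product
measures. *)
HB.lock Definition rpot (R : realType) (n : nat) (alpha : R)
    (m : {sigma_finite_measure set (borel R n) -> \bar R}) (x : 'rV[R]_n) : \bar R :=
  (\int[m]_y riesz_kernel alpha x y)%E.

HB.lock Definition rform (R : realType) (n : nat) (alpha : R)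
    (m1 m2 : {sigma_finite_measure set (borel R n) -> \bar R}) : \bar R :=
  (\int[m1 \x m2]_z riesz_kernel alpha z.1 z.2)%E.

HB.lock Definition feature (R : realType) (n : nat) (Z : Type) (H : 'rV[R]_n -> Z -> R)
    (m : {sigma_finite_measure set (borel R n) -> \bar R}) (z : Z) : \bar R :=
  (\int[m]_x (H x z)%:E)%E.

Section energy_form.
Context {R : realType} {n : nat} (alpha : R).
Notation X := (borel R n).
Notation sfm := {sigma_finite_measure set X -> \bar R}.
Implicit Types m : sfm.
Local Open Scope ereal_scope.

Notation rpot := (rpot alpha).
Notation rform := (rform alpha).

Lemma rpotE m x : rpot m x = \int[m]_y riesz_kernel alpha x y.
Proof. by rewrite unlock. Qed.

Lemma rformE m1 m2 : rform m1 m2 = \int[m1 \x m2]_z riesz_kernel alpha z.1 z.2.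
Proof. by rewrite unlock. Qed.

Lemma rpot_ge0 m x : 0 <= rpot m x.
Proof. by rewrite rpotE; apply: integral_ge0 => y _; exact: riesz_kernel_ge0. Qed.

Lemma rform_ge0 m1 m2 : 0 <= rform m1 m2.
Proof. by rewrite rformE; apply: integral_ge0 => z _; exact: riesz_kernel_ge0. Qed.

Lemma rpot_borel m : measurable_fun setT (rpot m : X -> \bar R).
Proof.
rewrite (_ : rpot m = fun x => \int[m]_y riesz_kernel alpha x y); last first.
  by apply/funext => x; rewrite rpotE.
apply: (measurable_fun_fubini_tonelli_F (fun z : X * X => riesz_kernel alpha z.1 z.2)).
  exact: riesz_kernel_borel.
by move=> z; exact: riesz_kernel_ge0.
Qed.

Lemma rform_rpot m1 m2 : rform m1 m2 = \int[m1]_x rpot m2 x.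
Proof.
rewrite rformE fubini_tonelli1.
- by apply: eq_integral => x _; rewrite rpotE.
- exact: riesz_kernel_borel.
- by move=> z; exact: riesz_kernel_ge0.
Qed.

Lemma rformC m1 m2 : rform m1 m2 = rform m2 m1.
Proof.
rewrite rform_rpot rformE fubini_tonelli2.
- by apply: eq_integral => x _; rewrite rpotE; apply: eq_integral => y _; rewrite riesz_kernel_sym.
- exact: riesz_kernel_borel.
- by move=> z; exact: riesz_kernel_ge0.
Qed.

Lemma rformDl m12 m1 m2 m : (forall B, measurable B -> m12 B = m1 B + m2 B) ->
  rform m12 m = rform m1 m + rform m2 m.
Proof.
move=> mE; rewrite !rform_rpot (eq_measure_integral (measure_add m1 m2)); last first.
  by move=> B mB _; rewrite [LHS]mE//; exact/esym/measure_addE.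
rewrite ge0_integral_measure_add//; first by move=> x _; exact: rpot_ge0.
exact: rpot_borel.
Qed.

Lemma rformDr m12 m1 m2 m : (forall B, measurable B -> m12 B = m1 B + m2 B) ->
  rform m m12 = rform m m1 + rform m m2.
Proof. by move=> mE; rewrite ![rform m _]rformC; exact: rformDl. Qed.

Lemma rformZl m' m1 (r : R) m : (0 <= r)%R -> (forall B, measurable B -> m' B = r%:E * m1 B) ->
  rform m' m = r%:E * rform m1 m.
Proof.
move=> r0 mE; rewrite !rform_rpot (eq_measure_integral (mscale (NngNum r0) m1)); last first.
  by move=> B mB _; rewrite /mscale/=; exact: mE.
by rewrite ge0_integral_mscale//; [exact: rpot_borel|move=> x _; exact: rpot_ge0].
Qed.

Lemma rformZr m' m1 (r : R) m : (0 <= r)%R -> (forall B, measurable B -> m' B = r%:E * m1 B) ->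
  rform m m' = r%:E * rform m m1.
Proof. by move=> r0 mE; rewrite ![rform m _]rformC; exact: rformZl. Qed.

Lemma rform_zerol m' m : (forall B, measurable B -> m' B = 0) -> rform m' m = 0.
Proof.
by move=> m0; rewrite (@rformZl m' m' 0%R) ?mul0e// => B mB; rewrite mul0e m0.
Qed.

Lemma rform_zeror m' m : (forall B, measurable B -> m' B = 0) -> rform m m' = 0.
Proof. by move=> m0; rewrite rformC; exact: rform_zerol. Qed.

Lemma le_rforml m' m1 m2 m : (forall B, measurable B -> m1 B = m' B + m2 B) ->
  rform m' m <= rform m1 m.
Proof. by move=> mE; rewrite (rformDl _ mE) leeDl// rform_ge0. Qed.

Lemma le_rformr m' m1 m2 m : (forall B, measurable B -> m1 B = m' B + m2 B) ->
  rform m m' <= rform m m1.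
Proof. by move=> mE; rewrite (rformDr _ mE) leeDl// rform_ge0. Qed.

End energy_form.

Section feature_space.
Context {R : realType} {n : nat} (alpha : R).
Notation X := (borel R n).
Notation sfm := {sigma_finite_measure set X -> \bar R}.
Implicit Types m : sfm.
Context (c : R) d (Z : measurableType d) (rho : {sigma_finite_measure set Z -> \bar R})
  (H : 'rV[R]_n -> Z -> R).
Hypotheses (c_gt0 : (0 < c)%R)
  (H_borel : measurable_fun setT (fun p : X * Z => H p.1 p.2))
  (H_bound : forall z, exists B, forall x, (0 <= H x z <= B)%R)
  (H_repr : forall x y, (\int[rho]_z (H x z * H y z)%:E = c%:E * riesz_kernel alpha x y)%E).
Local Open Scope ereal_scope.

Notation feature := (feature H).

Lemma featureE m z : feature m z = \int[m]_x (H x z)%:E.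
Proof. by rewrite unlock. Qed.

Lemma kernel_factor_ge0 x z : (0 <= H x z)%R.
Proof. by have [B /(_ x)/andP[]] := H_bound z. Qed.

Lemma kernel_factor_borel z : measurable_fun setT (fun x : X => H x z).
Proof.
have mg : measurable_fun setT (fun x : X => (x, z)) by exact: measurable_fun_pair.
exact: (measurableT_comp H_borel mg).
Qed.

Lemma feature_ge0 m z : 0 <= feature m z.
Proof. by rewrite featureE; apply: integral_ge0 => x _; rewrite lee_fin kernel_factor_ge0. Qed.

Lemma feature_measurable m : measurable_fun setT (feature m).
Proof.
rewrite (_ : feature m = fun z => \int[m]_x (H x z)%:E); last first.
  by apply/funext => z; rewrite featureE.
apply: (measurable_fun_fubini_tonelli_G (fun p : X * Z => (H p.1 p.2)%:E)).
  exact/measurable_EFinP.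
by move=> p; rewrite lee_fin kernel_factor_ge0.
Qed.

Lemma feature_fin m z : m setT < +oo -> feature m z \is a fin_num.
Proof.
move=> mfin; have [B HB] := H_bound z.
rewrite ge0_fin_numE ?feature_ge0// featureE.
apply: (@le_lt_trans _ _ (\int[m]_x B%:E)).
  apply: ge0_le_integral => //.
  - by move=> x _; rewrite lee_fin kernel_factor_ge0.
  - by apply/measurable_EFinP; exact: kernel_factor_borel.
  - by move=> x _; rewrite lee_fin; have /andP[] := HB x.
rewrite integral_cst//; have [B0|B0] := leP 0%R B; first exact: lte_mul_pinfty.
by rewrite (@le_lt_trans _ _ 0)// mule_le0_ge0// lee_fin ltW.
Qed.

(** Tonelli on the triple product: the energy form is the inner product of the
features in L^2([rho]). All positive definiteness of the kernel comes from
here. *)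
Lemma rform_feature m1 m2 :
  c%:E * rform alpha m1 m2 = \int[rho]_z (feature m1 z * feature m2 z).
Proof.
pose f (p : (X * X) * Z) := (H p.1.1 p.2 * H p.1.2 p.2)%:E.
have mf : measurable_fun setT f.
  apply/measurable_EFinP; apply: measurable_funM.
    have mg : measurable_fun setT (fun p : (X * X) * Z => (p.1.1, p.2)).
      by apply: measurable_fun_pair => //; exact: (measurableT_comp measurable_fst measurable_fst).
    exact: (measurableT_comp H_borel mg).
  have mg : measurable_fun setT (fun p : (X * X) * Z => (p.1.2, p.2)).
    by apply: measurable_fun_pair => //; exact: (measurableT_comp measurable_snd measurable_fst).
  exact: (measurableT_comp H_borel mg).
have f0 p : 0 <= f p by rewrite lee_fin mulr_ge0// kernel_factor_ge0.
transitivity (\int[sfprod m1 m2]_w \int[rho]_z f (w, z)).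
  rewrite rformE -ge0_integralZl_EFin//.
  - by apply: eq_integral => w _; rewrite -H_repr.
  - by move=> w _; exact: riesz_kernel_ge0.
  - exact: riesz_kernel_borel.
  - exact: ltW.
rewrite (fubini_tonelli f mf f0); apply: eq_integral => z _.
rewrite /sfprod fubini_tonelli1; last 2 first.
- have mg : measurable_fun setT (fun w : X * X => (w, z)) by exact: measurable_fun_pair.
  exact: (measurableT_comp mf mg).
- by move=> w; exact: f0.
have mHz : measurable_fun setT (fun x : X => (H x z)%:E) by apply/measurable_EFinP; exact: kernel_factor_borel.
transitivity (\int[m1]_x ((H x z)%:E * feature m2 z)).
  apply: eq_integral => x _; rewrite /fubini_F/= /f/=.
  under eq_integral do rewrite EFinM.
  by rewrite ge0_integralZl_EFin ?kernel_factor_ge0 ?featureE// => y _; rewrite lee_fin kernel_factor_ge0.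
by rewrite ge0_integralZr ?feature_ge0 ?[feature m1 z]featureE// => x _; rewrite lee_fin kernel_factor_ge0.
Qed.

Lemma le_cmul (a b : \bar R) : c%:E * a <= c%:E * b -> a <= b.
Proof. by rewrite lee_pmul2l ?lte_fin. Qed.

Let mff m1 m2 : measurable_fun setT (fun z => feature m1 z * feature m2 z).
Proof. by apply: emeasurable_funM; exact: feature_measurable. Qed.

Let ff0 m1 m2 z : 0 <= feature m1 z * feature m2 z.
Proof. by rewrite mule_ge0// feature_ge0. Qed.

Lemma rform_amgm_features m1 m2 :
  2%:E * rform alpha m1 m2 <= rform alpha m1 m1 + rform alpha m2 m2.
Proof.
apply: le_cmul; rewrite muleCA ge0_muleDr ?rform_ge0// !rform_feature.
rewrite -ge0_integralZl_EFin// -ge0_integralD//.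
apply: ge0_le_integral => //.
- by move=> z _; rewrite mule_ge0.
- by apply: emeasurable_funM.
- by apply: emeasurable_funD.
- by move=> z _; apply: ereal_amgm; exact: feature_ge0.
Qed.

(** Nonnegativity of the energy of [m1 + t * m3 - m2], obtained by integrating
[ereal_three_term]. It is the form of the Cauchy-Schwarz inequality for a
difference of measures that makes sense without subtracting infinite
energies. *)
Lemma rform_three_term_features m1 m2 m3 (t : R) : (0 < t)%R ->
  2%:E * rform alpha m1 m2 + (2 * t)%:E * rform alpha m3 m2 <=
  rform alpha m1 m1 + (2 * t)%:E * rform alpha m1 m3 +
  (t ^+ 2)%:E * rform alpha m3 m3 + rform alpha m2 m2.
Proof.
move=> t0; have t20 : (0 <= 2 * t)%R by rewrite mulr_ge0// ltW.
have tt0 : (0 <= t ^+ 2)%R by rewrite exprn_ge0// ltW.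
have h (r : R) m m' : (0 <= r)%R -> 0 <= r%:E * rform alpha m m' by move=> r0; rewrite mule_ge0// rform_ge0.
have hf (r : R) m m' z : (0 <= r)%R -> 0 <= r%:E * (feature m z * feature m' z) by move=> r0; rewrite mule_ge0.
apply: le_cmul; rewrite !ge0_muleDr ?adde_ge0 ?h ?rform_ge0// !(muleCA c%:E) !rform_feature.
have mr (r : R) m m' : measurable_fun setT (fun z => r%:E * (feature m z * feature m' z)).
  exact: emeasurable_funM.
rewrite -!ge0_integralZl_EFin//.
rewrite -!ge0_integralD//; last first.
all: try (by move=> *; rewrite ?adde_ge0 ?hf).
all: try (by repeat apply: emeasurable_funD).
apply: ge0_le_integral => //.
- by move=> *; rewrite ?adde_ge0 ?hf.
- by repeat apply: emeasurable_funD.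
- by repeat apply: emeasurable_funD.
- by move=> z _; apply: ereal_three_term => //; exact: feature_ge0.
Qed.

End feature_space.

(** * Strong limits of sequences that are Cauchy in energy *)

(** The inequality [(x + y)^2 <= 2 * x^2 + 2 * y^2], applied at each step to
the first difference and the rest, produces the weights [2 ^+ i.+1]; they are
affordable because the squared differences will be summable with ratio 1/4. *)
Lemma telescoping_sqr (R : realType) (p : nat -> R) N j :
  (p j - p (j + N)%N) ^+ 2 <=
  \sum_(0 <= i < N) 2 ^+ i.+1 * (p (j + i)%N - p (j + i).+1) ^+ 2.
Proof.
elim: N j => [|N ih] j; first by rewrite big_geq// addn0 subrr expr0n.
rewrite big_nat_recl// addn0 expr1.
under eq_bigr do rewrite addnS -addSn exprS -mulrA.
rewrite -mulr_sumr -mulrDr -addSnnS.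
apply: (@le_trans _ _ (2 * ((p j - p j.+1) ^+ 2 + (p j.+1 - p (j.+1 + N)%N) ^+ 2))).
  have := sqr_ge0 ((p j - p j.+1) - (p j.+1 - p (j.+1 + N)%N)); nra.
by rewrite ler_pM2l// lerD2l ih.
Qed.

Section strong_limit.
Context {R : realType} {n : nat} (alpha : R).
Notation X := (borel R n).
Notation sfm := {sigma_finite_measure set X -> \bar R}.
Context (c : R) d (Z : measurableType d) (rho : {sigma_finite_measure set Z -> \bar R})
  (H : 'rV[R]_n -> Z -> R).
Hypotheses (c_gt0 : (0 < c)%R)
  (H_borel : measurable_fun setT (fun p : X * Z => H p.1 p.2))
  (H_bound : forall z, exists B, forall x, (0 <= H x z <= B)%R)
  (H_repr : forall x y, (\int[rho]_z (H x z * H y z)%:E = c%:E * riesz_kernel alpha x y)%E).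
Local Open Scope ereal_scope.
Notation J := (rform alpha).

Lemma rform_lty_features (m1 m2 : sfm) : J m1 m1 < +oo -> J m2 m2 < +oo -> J m1 m2 < +oo.
Proof.
move=> h1 h2; have := rform_amgm_features c_gt0 H_borel H_bound H_repr m1 m2.
case: (J m1 m2) (rform_ge0 alpha m1 m2) => [r| |]//= _; rewrite ?ltry//.
rewrite gt0_muley ?lte_fin// => h; have := lte_add_pinfty h1 h2.
by rewrite ltNge h.
Qed.

Variables (mu : nat -> sfm) (m : sfm) (e : nat -> R).
Hypotheses (mu_fin : forall k, mu k setT < +oo) (m_fin : m setT < +oo)
  (e_ge0 : forall k, (0 <= e k)%R) (mu_J : forall k, J (mu k) (mu k) < +oo)
  (mu_cauchy : forall k, J (mu k) (mu k) + J (mu k.+1) (mu k.+1) <=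
     2%:E * J (mu k) (mu k.+1) + (e k)%:E)
  (mu_cluster : forall z (eps : R) N, (0 < eps)%R -> exists2 k, (N <= k)%N &
     (`|fine (feature H (mu k) z) - fine (feature H m z)| <= eps)%R).

Let p k z : R := fine (feature H (mu k) z).
Let a z : R := fine (feature H m z).
Let dif k z : R := ((p k z - p k.+1 z) ^+ 2)%R.

Let pE k z : feature H (mu k) z = (p k z)%:E.
Proof. by rewrite fineK// (feature_fin H_borel). Qed.

Let aE z : feature H m z = (a z)%:E.
Proof. by rewrite fineK// (feature_fin H_borel). Qed.

Let p_meas k : measurable_fun setT (p k).
Proof. by apply: measurableT_comp => //; exact: (feature_measurable H_borel H_bound). Qed.

Let a_meas : measurable_fun setT a.
Proof. by apply: measurableT_comp => //; exact: (feature_measurable H_borel H_bound). Qed.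

Let dif_meas k : measurable_fun setT (dif k).
Proof. by apply: measurable_funX; exact: measurable_funB. Qed.

Let p0 k z : (0 <= p k z)%R.
Proof. by rewrite -lee_fin -pE (feature_ge0 H_bound). Qed.

Let a0 z : (0 <= a z)%R.
Proof. by rewrite -lee_fin -aE (feature_ge0 H_bound). Qed.

Let Jpp j k : c%:E * J (mu j) (mu k) = \int[rho]_z (p j z * p k z)%:E.
Proof.
rewrite (rform_feature c_gt0 H_borel H_bound H_repr).
by apply: eq_integral => z _; rewrite !pE.
Qed.

Let integral_dif k : \int[rho]_z (dif k z)%:E <= c%:E * (e k)%:E.
Proof.
have Jfin : J (mu k) (mu k.+1) \is a fin_num.
  by rewrite ge0_fin_numE ?rform_ge0// rform_lty_features.
have c0 : (0 <= c)%R by exact: ltW.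
have : c%:E * (J (mu k) (mu k) + J (mu k.+1) (mu k.+1)) <=
    c%:E * (2%:E * J (mu k) (mu k.+1) + (e k)%:E) by rewrite lee_pmul2l ?lte_fin.
rewrite !ge0_muleDr ?mule_ge0 ?rform_ge0 ?lee_fin// muleCA !Jpp.
have mM i j : measurable_fun setT (fun z => (p i z * p j z)%:E).
  by apply/measurable_EFinP; exact: measurable_funM.
rewrite -ge0_integralZl_EFin//; last by move=> z _; rewrite lee_fin mulr_ge0.
rewrite -ge0_integralD//; last 2 first.
- by move=> z _; rewrite lee_fin mulr_ge0.
- by move=> z _; rewrite lee_fin mulr_ge0.
rewrite (eq_integral (fun z => 2%:E * (p k z * p k.+1 z)%:E + (dif k z)%:E)); last first.
  by move=> z _; rewrite -EFinM -!EFinD; congr EFin; rewrite /dif; ring.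
rewrite ge0_integralD//; last 4 first.
- by move=> z _; rewrite mule_ge0// lee_fin mulr_ge0.
- exact: emeasurable_funM.
- by move=> z _; rewrite lee_fin sqr_ge0.
- exact/measurable_EFinP.
rewrite leeD2lE// ge0_integralZl_EFin//; last by move=> z _; rewrite lee_fin mulr_ge0.
by rewrite -Jpp fin_numM// fin_numM.
Qed.

(** A common majorant of the squared distances from the feature of [mu j] to
all later ones. *)
Let S j z : \bar R := \sum_(0 <= i <oo) (2 ^+ i.+1 * dif (j + i)%N z)%:E.

Let term_ge0 j z i : 0 <= (2 ^+ i.+1 * dif (j + i)%N z)%:E.
Proof. by rewrite lee_fin mulr_ge0 ?sqr_ge0 ?exprn_ge0. Qed.

(** The features of [mu] come back arbitrarily close to the feature of [m], so
the bound on the distance to later features passes to the limit. *)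
Let S_ge j z : ((p j z - a z) ^+ 2)%:E <= S j z.
Proof.
have S0 : 0 <= S j z by apply: nneseries_ge0 => i _ _; exact: term_ge0.
have part N : ((p j z - p (j + N)%N z) ^+ 2)%:E <= S j z.
  apply: (@le_trans _ _ (\sum_(0 <= i < N) (2 ^+ i.+1 * dif (j + i)%N z)%:E)).
    by rewrite sumEFin lee_fin; exact: (telescoping_sqr (fun k => p k z)).
  by apply: nneseries_lim_ge => i _ _; exact: term_ge0.
(* an infinite majorant bounds everything; a finite one is compared after taking
   square roots *)
case: (S j z) S0 part => [s| |]//; last by move=> _ _; rewrite leey.
rewrite lee_fin => s0 part; rewrite lee_fin.
have h : (`|p j z - a z| <= Num.sqrt s)%R.
  apply/ler_addgt0Pr => eps eps0; have [k jk pk] := mu_cluster z j eps0.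
  have := part (k - j)%N; rewrite subnKC// lee_fin => pk'.
  have : (`|p j z - p k z| <= Num.sqrt s)%R by rewrite -sqrtr_sqr ler_sqrt.
  have -> : (p j z - a z = (p j z - p k z) + (p k z - a z))%R by ring.
  by move=> pk''; apply: (le_trans (ler_normD _ _)); exact: lerD.
by rewrite -real_normK ?num_real// -(sqr_sqrtr s0) lerXn2r// nnegrE ?sqrtr_ge0.
Qed.

Let mM (f g : Z -> R) : measurable_fun setT f -> measurable_fun setT g ->
  measurable_fun setT (fun z => (f z * g z)%:E).
Proof. by move=> mf mg; apply/measurable_EFinP; exact: measurable_funM. Qed.

Let mS j : measurable_fun setT (S j).
Proof.
apply: ge0_emeasurable_sum => [i z _ _|i _]; first exact: term_ge0.
by apply/measurable_EFinP; exact: measurable_funM.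
Qed.

Let S_ge0 j z : 0 <= S j z.
Proof. by apply: nneseries_ge0 => i _ _; exact: term_ge0. Qed.

Let integral_S j : \int[rho]_z S j z <=
  c%:E * \sum_(0 <= i <oo) (2 ^+ i.+1 * e (j + i)%N)%:E.
Proof.
rewrite integral_nneseries//; last by move=> i; apply/measurable_EFinP; exact: measurable_funM.
rewrite -nneseriesZl//; last by move=> i _; rewrite lee_fin mulr_ge0 ?exprn_ge0.
apply: lee_nneseries => i _.
- by move=> _; apply: integral_ge0 => z _; exact: term_ge0.
- under eq_integral do rewrite EFinM.
  rewrite ge0_integralZl_EFin ?exprn_ge0//; last 2 first.
  + by move=> z _; rewrite lee_fin sqr_ge0.
  + exact/measurable_EFinP.
  rewrite EFinM muleCA lee_pmul2l// ?lte_fin ?exprn_gt0//; exact: integral_dif.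
Qed.

(** The limit has finite energy, without which the conclusion of
[strong_limit_features] could be void. *)
Lemma strong_limit_energy j : J m m <=
  2%:E * J (mu j) (mu j) + 2%:E * \sum_(0 <= i <oo) (2 ^+ i.+1 * e (j + i)%N)%:E.
Proof.
have c0 : (0 <= c)%R by exact: ltW.
rewrite -(@lee_pmul2l _ c%:E) ?lte_fin//.
have se0 : 0 <= \sum_(0 <= i <oo) (2 ^+ i.+1 * e (j + i)%N)%:E.
  by apply: nneseries_ge0 => i _ _; rewrite lee_fin mulr_ge0 ?exprn_ge0.
rewrite ge0_muleDr ?mule_ge0 ?rform_ge0// !(muleCA c%:E) Jpp.
rewrite (rform_feature c_gt0 H_borel H_bound H_repr).
rewrite (eq_integral (fun z => (a z * a z)%:E)); last by move=> z _; rewrite aE.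
apply: (@le_trans _ _ (\int[rho]_z (2%:E * (p j z * p j z)%:E + 2%:E * S j z))).
  apply: ge0_le_integral => //.
  - by move=> z _; rewrite lee_fin mulr_ge0.
  - exact: mM.
  - by apply: emeasurable_funD; apply: emeasurable_funM => //; exact: mM.
  - move=> z _; have := S_ge j z; case: (S j z) => [s| |].
    + rewrite -!EFinM -!EFinD !lee_fin => h; have := sqr_ge0 (2 * p j z - a z); nra.
    + by rewrite gt0_muley ?lte_fin// addey ?leey.
    + by rewrite leeNy_eq.
rewrite ge0_integralD//; last 4 first.
- by move=> z _; rewrite mule_ge0// lee_fin mulr_ge0.
- by apply: emeasurable_funM => //; exact: mM.
- by move=> z _; rewrite mule_ge0.
- by apply: emeasurable_funM.
rewrite !ge0_integralZl_EFin//; last 2 first.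
- by move=> z _; rewrite lee_fin mulr_ge0.
- exact: mM.
by apply: leeD => //; rewrite lee_pmul2l// integral_S.
Qed.

(** In terms of the norm, the squared distance from [mu j] to [m] is at most
the sum of the series; it is written without subtraction. *)
Lemma strong_limit_features j : J (mu j) (mu j) + J m m <=
  2%:E * J (mu j) m + \sum_(0 <= i <oo) (2 ^+ i.+1 * e (j + i)%N)%:E.
Proof.
have c0 : (0 <= c)%R by exact: ltW.
rewrite -(@lee_pmul2l _ c%:E) ?lte_fin//.
have se0 : 0 <= \sum_(0 <= i <oo) (2 ^+ i.+1 * e (j + i)%N)%:E.
  by apply: nneseries_ge0 => i _ _; rewrite lee_fin mulr_ge0 ?exprn_ge0.
rewrite !ge0_muleDr ?mule_ge0 ?rform_ge0// muleCA.
rewrite !(rform_feature c_gt0 H_borel H_bound H_repr).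
rewrite [X in X + _ <= _](eq_integral (fun z => (p j z * p j z)%:E)); last by move=> z _; rewrite pE.
rewrite [X in _ + X <= _](eq_integral (fun z => (a z * a z)%:E)); last by move=> z _; rewrite aE.
rewrite [X in 2%:E * X](eq_integral (fun z => (p j z * a z)%:E)); last by move=> z _; rewrite aE pE.
rewrite -ge0_integralZl_EFin//; last 2 first.
- by move=> z _; rewrite lee_fin mulr_ge0.
- exact: mM.
rewrite -ge0_integralD//; last 4 first.
- by move=> z _; rewrite lee_fin mulr_ge0.
- exact: mM.
- by move=> z _; rewrite lee_fin mulr_ge0.
- exact: mM.
apply: (@le_trans _ _ (\int[rho]_z (2%:E * (p j z * a z)%:E + S j z))).
  apply: ge0_le_integral => //.
  - by move=> z _; rewrite -EFinD lee_fin addr_ge0// mulr_ge0.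
  - by apply: emeasurable_funD; exact: mM.
  - by apply: emeasurable_funD => //; apply: emeasurable_funM => //; exact: mM.
  - move=> z _; have := S_ge j z; case: (S j z) => [s| |]; rewrite ?addey ?leey ?leeNy_eq//.
    by rewrite -EFinM -!EFinD !lee_fin; nra.
rewrite ge0_integralD//; last 2 first.
- by move=> z _; rewrite mule_ge0// lee_fin mulr_ge0.
- by apply: emeasurable_funM => //; exact: mM.
by rewrite leeD2l// integral_S.
Qed.

End strong_limit.

Section positive_definite.
Context {R : realType} {n : nat} (alpha : R) (alpha_lt : alpha < n%:R).
Notation sfm := {sigma_finite_measure set (borel R n) -> \bar R}.
Implicit Types m : sfm.
Notation J := (rform alpha).
Local Open Scope ereal_scope.

Lemma rform_amgm m1 m2 : 2%:E * J m1 m2 <= J m1 m1 + J m2 m2.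
Proof.
have [c [d [Z [rho [H [c0 mH _ bH rH]]]]]] := riesz_features alpha_lt.
exact: (rform_amgm_features c0 mH bH rH).
Qed.

Lemma rform_lty m1 m2 : J m1 m1 < +oo -> J m2 m2 < +oo -> J m1 m2 < +oo.
Proof.
have [c [d [Z [rho [H [c0 mH _ bH rH]]]]]] := riesz_features alpha_lt.
exact: (rform_lty_features c0 mH bH rH).
Qed.

Lemma rform_three_term m1 m2 m3 (t : R) : (0 < t)%R ->
  2%:E * J m1 m2 + (2 * t)%:E * J m3 m2 <=
  J m1 m1 + (2 * t)%:E * J m1 m3 + (t ^+ 2)%:E * J m3 m3 + J m2 m2.
Proof.
have [c [d [Z [rho [H [c0 mH _ bH rH]]]]]] := riesz_features alpha_lt.
exact: (rform_three_term_features c0 mH bH rH).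
Qed.

End positive_definite.

(** * Borel measures from contents on compact sets *)

Section euclidean_topology.
Context {R : realType} {n : nat}.
Notation V := ('rV[R]_n).
Implicit Types (O K : set V).

(** The points at sup-norm depth at least [k.+1%:R^-1] in [O]; these closed
sets exhaust an open [O]. *)
Definition erosion O (k : nat) : set V := [set x | ball x k.+1%:R^-1 `<=` O].

Lemma closed_erosion O k : closed (erosion O k).
Proof.
rewrite -[erosion O k]setCK; apply: open_closedC; rewrite openE => x /= /existsNP[y /not_implyP[xy Oy]].
have : nbhs x (ball y k.+1%:R^-1).
  by apply: open_nbhs_nbhs; split; [exact: ball_open|exact: ball_sym].
by apply: filterS => x' yx' h; apply: Oy; apply: h; exact: ball_sym.
Qed.

Lemma erosion_sub O k : erosion O k `<=` O.
Proof. by move=> x; apply; apply: ballxx; rewrite invr_gt0. Qed.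

(** By compactness some uniform depth [N] works: every point of [K] is at that
depth in one of the first [N] open sets, and the pieces
[K `&` erosion (O i) N] are compact. This replaces a partition of unity in the
proof of subadditivity. *)
Lemma compact_split K (O : nat -> set V) :
  compact K -> (forall i, open (O i)) -> K `<=` \bigcup_i O i ->
  exists (N : nat) (L : nat -> set V), [/\ forall i, compact (L i),
    forall i, L i `<=` O i & K `<=` \big[setU/set0]_(i < N) L i].
Proof.
move=> cK oO KO.
have /compact_near_coveringP cov := cK.
have := cov nat \oo (fun k x => exists2 i, (i < k)%N & erosion (O i) k x) _ _.
case.
  move=> x Kx; have [i _ Oix] := KO _ Kx.
  have /nbhs_ballP[e /= e0 eO] : nbhs x (O i) by exact: open_nbhs_nbhs.
  have e20 : 0 < e / 2 by rewrite divr_gt0.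
  have [N _ HN] := near_infty_natSinv_lt (PosNum e20).
  exists (ball x (e / 2), [set k | (i < k)%N /\ (k.+1%:R^-1 : R) < e / 2]) => /=.
    split; first exact: nbhsx_ballx.
    exists (maxn N i.+1) => // k /=; rewrite geq_max => /andP[Nk ik]; split => //.
    exact: HN.
  move=> [x' k] [/= xx' [ik ke]]; exists i => // y xy; apply: eO.
  by rewrite [e]splitr; apply: ball_triangle xx' _; apply: le_ball xy; exact: ltW.
move=> N _ /(_ N (leqnn N)) KN.
exists N, (fun i => K `&` erosion (O i) N); split.
- by move=> i; apply: compact_closedI => //; exact: closed_erosion.
- by move=> i x [_ /erosion_sub].
- move=> x Kx; have [i iN Oi] := KN x Kx; rewrite -(bigcup_mkord N (fun i => K `&` erosion (O i) N)).
  by exists i.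
Qed.

End euclidean_topology.

(** The classical construction of a regular Borel measure from a content: a
set function on compact sets that is monotone, subadditive, and additive on
disjoint sets. Open sets are measured from inside, arbitrary sets from
outside, and Borel sets are measurable in the sense of Caratheodory because
open ones are. *)
Section content_extension.
Context {R : realType} {n : nat}.
Notation V := ('rV[R]_n).
Variable l : set V -> \bar R.
Local Open Scope ereal_scope.
Hypotheses (l0 : l set0 = 0) (l_ge0 : forall K, compact K -> 0 <= l K)
  (l_le1 : forall K, compact K -> l K <= 1)
  (l_mono : forall K L, compact K -> compact L -> K `<=` L -> l K <= l L)
  (l_sub : forall K L, compact K -> compact L -> l (K `|` L) <= l K + l L)
  (l_add : forall K L, compact K -> compact L -> K `&` L = set0 -> l K + l L <= l (K `|` L)).

Definition inner_content (O : set V) : \bar R :=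
  ereal_sup [set l K | K in [set K | compact K /\ K `<=` O]].

Definition outer_content (E : set V) : \bar R :=
  ereal_inf [set inner_content O | O in [set O | open O /\ E `<=` O]].

Let inner_ub O K : compact K -> K `<=` O -> l K <= inner_content O.
Proof. by move=> cK KO; apply: ereal_sup_ubound; exists K. Qed.

Let inner_ge0 O : 0 <= inner_content O.
Proof. by rewrite -l0; apply: inner_ub => //; exact: compact0. Qed.

Let inner_le1 O : inner_content O <= 1.
Proof. by apply: ge_ereal_sup => _ [K [cK _] <-]; exact: l_le1. Qed.

Let inner_mono O U : O `<=` U -> inner_content O <= inner_content U.
Proof.
move=> OU; apply: ge_ereal_sup => _ [K [cK KO] <-]; apply: inner_ub => //.
exact: subset_trans OU.
Qed.

Let outer_lb E O : open O -> E `<=` O -> outer_content E <= inner_content O.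
Proof. by move=> oO EO; apply: ereal_inf_lbound; exists O. Qed.

Lemma outer_content_open O : open O -> outer_content O = inner_content O.
Proof.
move=> oO; apply/eqP; rewrite eq_le outer_lb//=.
by apply: le_ereal_inf_tmp => _ [U [oU OU] <-]; exact: inner_mono.
Qed.

Lemma outer_content_compact K : compact K -> l K <= outer_content K.
Proof. by move=> cK; apply: le_ereal_inf_tmp => _ [U [oU KU] <-]; exact: inner_ub. Qed.

Let l_finite_sub N (L : nat -> set V) : (forall i, compact (L i)) ->
  l (\big[setU/set0]_(i < N) L i) <= \sum_(i < N) l (L i).
Proof.
move=> cL; elim: N => [|N ih]; first by rewrite !big_ord0 l0.
rewrite !big_ord_recr/=; apply: le_trans (l_sub _ _) _ => //.
  by apply: bigsetU_compact => i _; exact: cL.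
exact: leeD2r.
Qed.

Let inner_sigma_sub (O : nat -> set V) : (forall i, open (O i)) ->
  inner_content (\bigcup_i O i) <= \sum_(i <oo) inner_content (O i).
Proof.
move=> oO; apply: ge_ereal_sup => _ [K [cK KO] <-].
have [N [L [cL LO KL]]] := compact_split cK oO KO.
apply: (@le_trans _ _ (\sum_(i < N) l (L i))).
  apply: le_trans (l_finite_sub _ _) => //; apply: l_mono => //.
  by apply: bigsetU_compact => i _; exact: cL.
apply: (@le_trans _ _ (\sum_(i < N) inner_content (O i))).
  by apply: lee_sum => i _; exact: inner_ub.
rewrite -(big_mkord xpredT (fun i => inner_content (O i))).
by apply: nneseries_lim_ge => i _ _; exact: inner_ge0.
Qed.

Let outer_ge0 E : 0 <= outer_content E.
Proof. by apply: le_ereal_inf_tmp => _ [U _ <-]. Qed.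

Let outer_le1 E : outer_content E <= 1.
Proof. by apply: le_trans (inner_le1 setT); apply: outer_lb => //; exact: openT. Qed.

Let outer0 : outer_content set0 = 0.
Proof.
rewrite outer_content_open; last exact: open0.
apply/eqP; rewrite eq_le inner_ge0 andbT; apply: ge_ereal_sup => x [K [_ ]].
by rewrite subset0 => -> <-; rewrite l0.
Qed.

Let outer_mono : {homo outer_content : A B / A `<=` B >-> A <= B}.
Proof.
move=> A B AB; apply: le_ereal_inf_tmp => _ [U [oU BU] <-]; apply: outer_lb => //.
exact: subset_trans BU.
Qed.

Let outer_sigma_sub : sigma_subadditive outer_content.
Proof.
move=> E; apply/lee_addgt0Pr => e e0.
have e2 i : (0 < e / (2 ^ i.+1)%:R)%R by rewrite divr_gt0// ltr0n expn_gt0.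
have /choice[U HU] : forall i, exists U, [/\ open U, E i `<=` U &
    inner_content U <= outer_content (E i) + (e / (2 ^ i.+1)%:R)%:E].
  move=> i; have ofin : outer_content (E i) \is a fin_num.
    by rewrite ge0_fin_numE// (le_lt_trans (outer_le1 _))// ltry.
  have [_ [U [oU EU] <-] /ltW h] := lb_ereal_inf_adherent (e2 i) ofin.
  by exists U.
apply: (@le_trans _ _ (\sum_(i <oo) (outer_content (E i) + (e / (2 ^ i.+1)%:R)%:E))); last first.
  by apply: epsilon_trick => //; exact: ltW.
apply: (@le_trans _ _ (inner_content (\bigcup_i U i))).
  apply: outer_lb; first by apply: bigcup_open => i _; have [] := HU i.
  by apply: subset_bigcup => i _; have [] := HU i.
apply: le_trans (inner_sigma_sub _) _; first by move=> i; have [] := HU i.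
by apply: lee_nneseries => // i _; have [] := HU i.
Qed.

HB.instance Definition _ := isOuterMeasure.Build R V outer_content
  outer0 outer_ge0 outer_mono outer_sigma_sub.

(** If [K] is a compact part of [U `&` O] and [L] a compact part of
[U `&` ~` K], then [K] and [L] are disjoint, so additivity of the content
bounds [l K + l L] by the inner content of [U]. Now let [L], then [K], exhaust
their open sets. *)
Let caratheodory_open O : open O -> outer_content.-caratheodory O.
Proof.
move=> oO; apply: le_caratheodory_measurable => X.
apply: le_ereal_inf_tmp => _ [U [oU XU] <-].
have fin E : outer_content E \is a fin_num.
  by rewrite ge0_fin_numE// (le_lt_trans (outer_le1 _))// ltry.
have oUO : open (U `&` O) by exact: openI.
apply: (@le_trans _ _ (inner_content (U `&` O) + outer_content (X `&` ~` O))).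
  by rewrite leeD2r// outer_lb// => x [Xx Ox]; split => //; exact: XU.
rewrite -leeBrDr//; apply: ge_ereal_sup => _ [K [cK KUO] <-].
have lKfin : l K \is a fin_num by rewrite ge0_fin_numE ?l_ge0// (le_lt_trans (l_le1 cK))// ltry.
rewrite leeBrDr// -leeBrDl//.
have oUK : open (U `&` ~` K).
  apply: openI => //; apply: closed_openC; exact: compact_closed.
apply: (@le_trans _ _ (inner_content (U `&` ~` K))).
  apply: outer_lb => // x [Xx Ox]; split; first exact: XU.
  by move=> /KUO[].
apply: ge_ereal_sup => _ [L [cL LUK] <-]; rewrite leeBrDl//.
apply: le_trans (l_add cK cL _) _.
  by apply/seteqP; split => // x [Kx /LUK[]].
apply: inner_ub; first exact: compactU.
by move=> x [/KUO[]|/LUK[]].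
Qed.

Let borel_caratheodory (B : set (borel R n)) : measurable B -> outer_content.-caratheodory B.
Proof.
move: B; apply: smallest_sub; last exact: caratheodory_open.
split.
- exact: caratheodory_measurable_set0.
- by move=> A; rewrite setTD; exact: caratheodory_measurable_setC.
- by move=> F mF; exact: caratheodory_measurable_bigcup.
Qed.

Let outer_sigma_additive : semi_sigma_additive (outer_content : set (borel R n) -> \bar R).
Proof.
move=> F mF tF mU.
apply: (@caratheodory_measure_sigma_additive R V outer_content) => //.
- by move=> i; exact: borel_caratheodory.
- exact: borel_caratheodory.
Qed.

Lemma content_extension : exists m : {measure set (borel R n) -> \bar R},
  [/\ m setT <= 1, forall K, compact K -> l K <= m K &
      forall O, open O -> m O = inner_content O].
Proof.
pose mM := isMeasure.Build _ (borel R n) R (outer_content : set (borel R n) -> \bar R)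
  outer0 outer_ge0 outer_sigma_additive.
pose m : {measure set (borel R n) -> \bar R} := HB.pack (outer_content : set (borel R n) -> \bar R) mM.
exists m; split.
- exact: outer_le1.
- exact: outer_content_compact.
- exact: outer_content_open.
Qed.

End content_extension.

(** * Weak cluster points of tight sequences *)

Section ultrafilter_limits.
Context {R : realType} {I : Type} (F : set_system I) {FU : UltraFilter F}.

Lemma ultra_fmap (T : Type) (f : I -> T) : UltraFilter (f @ F).
Proof.
split; first exact: fmap_proper_filter.
move=> G PG FG; apply/seteqP; split => // B GB.
have [//|FnB] := @in_ultra_setVsetC _ F (f @^-1` B) FU.
have GnB : G (~` B) by exact: FG.
exfalso; apply: (@filter_not_empty _ G PG); rewrite -(setICr B).
exact: filterI.
Qed.

Lemma ultra_cvg_unit (a : I -> R) : (forall i, 0 <= a i <= 1) -> exists l : R, a @ F --> l.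
Proof.
move=> a01; have := @segment_compact R 0 1; rewrite compact_ultra => /(_ (a @ F)).
case; first exact: ultra_fmap.
  by apply: (@filterS _ F _ setT); [move=> i _ /=; rewrite in_itv/= a01|exact: filterT].
by move=> l [_ al]; exists l.
Qed.

End ultrafilter_limits.

Section weak_cluster.
Context {R : realType} {n : nat}.
Notation X := (borel R n).
Local Open Scope ereal_scope.

(** Along an ultrafilter the masses of each Borel set converge. The limits
need not form a measure, but on compact sets they are a content; the measure
generated by it satisfies the semicontinuity on open sets that characterizes
weak convergence. Tightness guarantees that it has mass one. *)
Lemma weak_cluster_exists (mu : nat -> {measure set X -> \bar R}) :
  (forall k, mu k setT = 1) ->
  (forall e : R, (0 < e)%R -> exists2 K : set 'rV[R]_n, compact K &
     forall k, mu k (~` K) <= e%:E) ->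
  exists (m : {measure set X -> \bar R}) (F : set_system nat),
    [/\ UltraFilter F, \oo `<=` F, m setT = 1 &
        forall (O : set 'rV[R]_n) (r : R), open O -> r%:E < m O ->
          F [set k | r%:E < mu k O]].
Proof.
move=> mu1 tight.
have [F [FU ooF]] := ultraFilterLemma (@eventually_filter).
have mK (K : set 'rV[R]_n) : compact K -> measurable (K : set X).
  by move=> cK; apply: closed_borel; exact: compact_closed.
have mule1 k (B : set X) : measurable B -> mu k B <= 1.
  by move=> mB; rewrite -(mu1 k); apply: le_measure; rewrite ?inE.
have mufin k (B : set X) : measurable B -> mu k B \is a fin_num.
  by move=> mB; rewrite ge0_fin_numE// (le_lt_trans (mule1 _ _ mB))// ltry.
pose a (B : set X) k : R := fine (mu k B).
have aE B k : measurable B -> (a B k)%:E = mu k B by move=> mB; rewrite fineK// mufin.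
pose L (B : set X) : R := lim (a B @ F).
have aL (B : set X) : measurable B -> a B @ F --> L B.
  move=> mB; have [l al] : exists l : R, a B @ F --> l.
    by apply: ultra_cvg_unit => k; rewrite -!lee_fin aE// mule1// measure_ge0.
  by rewrite /L (cvg_lim _ al).
have PF : ProperFilter F := ultra_proper.
have Lge0 B : measurable B -> (0 <= L B)%R.
  move=> mB; apply: (ler_cvg_to (@cvg_cst _ _ _ F _) (aL _ mB)).
  by apply: nearW => k; rewrite -lee_fin aE.
have Lle1 B : measurable B -> (L B <= 1)%R.
  move=> mB; apply: (ler_cvg_to (aL _ mB) (@cvg_cst _ _ _ F _)).
  by apply: nearW => k; rewrite -lee_fin aE// mule1.
have [] := @content_extension R n (fun B => (L B)%:E).
- congr EFin; apply: cvg_lim => //; rewrite (_ : a set0 = cst 0%R); first exact: cvg_cst.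
  by apply/funext => k; rewrite /a measure0.
- by move=> K cK; rewrite lee_fin Lge0//; exact: mK.
- by move=> K cK; rewrite lee_fin Lle1//; exact: mK.
- move=> K K' /mK mK1 /mK mK2 KK'; rewrite lee_fin.
  apply: (ler_cvg_to (aL _ mK1) (aL _ mK2)).
  by apply: nearW => k; rewrite -lee_fin !aE// le_measure// inE.
- move=> K K' /mK mK1 /mK mK2; rewrite -EFinD lee_fin.
  apply: (ler_cvg_to (aL _ (measurableU _ _ mK1 mK2)) (cvgD (aL _ mK1) (aL _ mK2))).
  apply: nearW => k; rewrite -lee_fin EFinD !aE//; last exact: measurableU.
  exact: measureU2.
- move=> K K' /mK mK1 /mK mK2 KK'; rewrite -EFinD lee_fin.
  apply: (ler_cvg_to (cvgD (aL _ mK1) (aL _ mK2)) (aL _ (measurableU _ _ mK1 mK2))).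
  apply: nearW => k; rewrite -lee_fin EFinD !aE//; last exact: measurableU.
  by rewrite measureU.
move=> m [m_le1 m_compact m_open]; exists m, F; split => //.
- apply/eqP; rewrite eq_le m_le1/=; apply/lee_addgt0Pr => e e0.
  have [K cK Ke] := tight e e0; have mKK := mK _ cK.
  apply: (@le_trans _ _ (m K + e%:E)); last first.
    by rewrite leeD2r// le_measure// inE.
  apply: (@le_trans _ _ ((L K)%:E + e%:E)); last by rewrite leeD2r// m_compact.
  rewrite -EFinD lee_fin -lerBlDr.
  apply: (ler_cvg_to (@cvg_cst _ _ _ F _) (aL _ mKK)).
  apply: nearW => k; rewrite lerBlDr -lee_fin EFinD aE//.
  rewrite -(mu1 k) -(setvU K) measureU//; last 2 first.
  + exact: measurableC.
  + exact: setICl.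
  by apply: (@le_trans _ _ (e%:E + mu k K)); [exact: (leeD2r (mu k K) (Ke k))|rewrite addeC].
- move=> O r oO; rewrite m_open// => /ereal_sup_gt[_ [K [cK KO] <-]].
  rewrite lte_fin => rK; have mKK := mK _ cK.
  have : \forall k \near F, (r < a K k)%R by exact: cvgr_gt (aL _ mKK) _ rK.
  apply: filterS => k /=; rewrite -lte_fin aE// => h; apply: (lt_le_trans h).
  by apply: le_measure; rewrite ?inE//; exact: open_borel.
Qed.

End weak_cluster.

Section portmanteau.
Context {R : realType} {n : nat}.
Notation X := (borel R n).

Lemma count_levels (N : nat) (s : R) : 0 <= s <= N%:R ->
  s <= \sum_(i < N) ((i%:R < s)%R)%:R <= s + 1.
Proof.
elim: N => [|N ih] /andP[s0 sN].
  by rewrite big_ord0 sN addr_ge0.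
rewrite big_ord_recr/=; have [Ns|sN'] := ltrP N%:R s.
  rewrite (eq_bigr (fun=> 1)); last first.
    by move=> i _; rewrite (lt_trans _ Ns)// ltr_nat.
  rewrite sumr_const card_ord natr1 sN/=.
  by rewrite -natr1 lerD2r ltW.
by rewrite addr0; apply: ih; rewrite s0.
Qed.

Local Open Scope ereal_scope.

(** A layer-cake approximation of [f] from above, with [N] equal layers of
height [B / N]. *)
Definition level_sum (f : 'rV[R]_n -> R) (B : R) (N : nat) (x : 'rV[R]_n) : R :=
  (B / N%:R * \sum_(i < N) \1_[set y | (B / N%:R * i%:R < f y)%R] x)%R.

Lemma level_sum_bounds f B N x : (0 < N)%N -> (0 < B)%R -> (0 <= f x <= B)%R ->
  (f x <= level_sum f B N x <= f x + B / N%:R)%R.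
Proof.
move=> N0 B0 /andP[f0 fB]; have BN0 : (0 < B / N%:R)%R by rewrite divr_gt0// ltr0n.
have NR : (N%:R != 0 :> R)%R by rewrite pnatr_eq0 -lt0n.
have := @count_levels N (f x / (B / N%:R)).
rewrite divr_ge0 ?(ltW BN0)//= ler_pdivrMr// [(N%:R * _)%R]mulrC divfK// => /(_ fB).
rewrite (eq_bigr (fun i : 'I_N => \1_[set y | (B / N%:R * i%:R < f y)%R] x)); last first.
  move=> i _; rewrite indicE ltr_pdivlMr// [(i%:R * _)%R]mulrC.
  by congr ((nat_of_bool _)%:R)%R; apply/idP/idP; rewrite inE.
move=> /andP[h1 h2]; apply/andP; split.
  by rewrite -ler_pdivrMl// mulrC.
rewrite /level_sum -ler_pdivlMl// mulrDr mulVf ?gt_eqF//.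
by rewrite [(_^-1 * f x)%R]mulrC.
Qed.

Lemma integral_level_sum (m : {measure set X -> \bar R}) f B N :
  (forall a, open [set x | (a < f x)%R]) -> (0 <= B)%R ->
  \int[m]_x (level_sum f B N x)%:E =
  (B / N%:R)%:E * \sum_(i < N) m [set y | (B / N%:R * i%:R < f y)%R].
Proof.
move=> f_open B0; have mf (a : R) : measurable ([set x | (a < f x)%R] : set X) by exact: open_borel.
under eq_integral do rewrite EFinM.
rewrite ge0_integralZl_EFin//; last 3 first.
- by move=> x _; rewrite lee_fin sumr_ge0// => i _; rewrite indicE.
- apply/measurable_EFinP; apply: measurable_sum => i; exact: measurable_indic.
- by rewrite divr_ge0.
congr (_ * _); under eq_integral do rewrite -sumEFin.
rewrite ge0_integral_sum//; last first.
  by move=> i; apply/measurable_EFinP; exact: measurable_indic.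
by apply: eq_bigr => i _; rewrite integral_indic// setIT.
Qed.

(** Semicontinuity passes from open sets to integrals: [f] is within [B / N]
of a positive combination of the indicators of the open sets where [f] exceeds
a level. *)
Lemma portmanteau_lsc (mu : nat -> {measure set X -> \bar R}) (m : {measure set X -> \bar R})
    (F : set_system nat) {FF : Filter F} (f : 'rV[R]_n -> R) (B : R) :
  (forall k, mu k setT = 1) -> m setT = 1 ->
  (forall (O : set 'rV[R]_n) (r : R), open O -> r%:E < m O -> F [set k | r%:E < mu k O]) ->
  (forall a, open [set x | (a < f x)%R]) -> (forall x, 0 <= f x <= B)%R ->
  forall r : R, r%:E < \int[m]_x (f x)%:E -> F [set k | r%:E < \int[mu k]_x (f x)%:E].
Proof.
move=> mu1 m1 cvO f_open fB r rf.
have mf : measurable_fun setT (f : X -> R) by exact: lsc_borel.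
have {B fB} [B B0 fB] : exists2 B, (0 < B)%R & forall x, (0 <= f x <= B)%R.
  exists (`|B| + 1)%R; first by rewrite ltr_pwDr.
  move=> x; have /andP[-> fx] := fB x.
  by rewrite (le_trans fx)// (le_trans (ler_norm B))// lerDl.
have f0 x : (0 <= f x)%R by have /andP[] := fB x.
have lev N := integral_level_sum _ N f_open (ltW B0).
have f_le (m' : {measure set X -> \bar R}) N : m' setT = 1 -> (0 < N)%N ->
    \int[m']_x (f x)%:E <= \int[m']_x (level_sum f B N x)%:E <= \int[m']_x (f x)%:E + (B / N%:R)%:E.
  move=> m'1 N0.
  have mL : measurable_fun setT (level_sum f B N : X -> R).
    apply: measurable_funM => //; apply: measurable_sum => i; apply: measurable_indic.
    exact: open_borel.
  have L0 x : (0 <= level_sum f B N x)%R.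
    by have /andP[h _] := level_sum_bounds N0 B0 (fB x); exact: le_trans h.
  apply/andP; split.
    apply: ge0_le_integral => //.
    - by move=> x _; rewrite lee_fin.
    - exact/measurable_EFinP.
    - exact/measurable_EFinP.
    - by move=> x _; rewrite lee_fin; have /andP[] := level_sum_bounds N0 B0 (fB x).
  rewrite -[leRHS](_ : \int[m']_x ((f x)%:E + (B / N%:R)%:E) = _); last first.
    rewrite ge0_integralD//.
    - by rewrite integral_cst// m'1 mule1.
    - by move=> x _; rewrite lee_fin.
    - exact/measurable_EFinP.
    - by move=> x _; rewrite lee_fin divr_ge0// ltW.
  apply: ge0_le_integral => //.
  - by move=> x _; rewrite lee_fin.
  - exact/measurable_EFinP.
  - by apply: emeasurable_funD => //; exact/measurable_EFinP.
  - by move=> x _; rewrite -EFinD lee_fin; have /andP[] := level_sum_bounds N0 B0 (fB x).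
have Ifin : \int[m]_x (f x)%:E \is a fin_num.
  rewrite ge0_fin_numE; last by apply: integral_ge0 => x _; rewrite lee_fin.
  have /andP[h _] := f_le m 1%N m1 isT; apply: (le_lt_trans h).
  rewrite lev lte_mul_pinfty ?lee_fin ?divr_ge0 ?ltW// big_ord1.
  rewrite (le_lt_trans _ (ltry 1%R))// -m1 le_measure// inE//.
  exact: open_borel.
pose v := fine (\int[m]_x (f x)%:E).
have vE : \int[m]_x (f x)%:E = v%:E by rewrite fineK.
move: rf; rewrite vE lte_fin => rv.
have e0 : (0 < (v - r) / 3)%R by rewrite divr_gt0// subr_gt0.
pose e := ((v - r) / 3)%R.
have [N N0 NB] : exists2 N, (0 < N)%N & (B / N%:R < e)%R.
  exists (Num.truncn (B / e)).+1 => //.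
  rewrite ltr_pdivrMr ?ltr0n// mulrC -ltr_pdivrMr//.
  by have /andP[] := truncn_itv (divr_ge0 (ltW B0) (ltW e0)).
have BN0 : (0 < B / N%:R)%R by rewrite divr_gt0// ltr0n.
pose U i := [set y : 'rV[R]_n | (B / N%:R * i%:R < f y)%R].
have mU i : measurable (U i : set X) by apply: open_borel; exact: f_open.
have mUfin i : m (U i) \is a fin_num.
  by rewrite ge0_fin_numE// (le_lt_trans _ (ltry 1%R))// -m1 le_measure// inE.
have near_all : F [set k | forall i : 'I_N, (fine (m (U i)) - e / B)%:E < mu k (U i)].
  apply: filter_forall => i; apply: cvO; first exact: f_open.
  by rewrite -[ltRHS]fineK// lte_fin ltrBlDr ltrDl divr_gt0.
apply: filterS near_all => k hk /=.
have /andP[_ h1] := f_le (mu k) N (mu1 k) N0.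
have /andP[h2 _] := f_le m N m1 N0.
rewrite lev in h1; rewrite lev vE in h2.
pose u (i : 'I_N) := fine (m (U i)).
have uE : \sum_(i < N) m (U i) = (\sum_(i < N) u i)%:E.
  by rewrite -sumEFin; apply: eq_bigr => i _; rewrite fineK.
(* each of the [N] layers loses at most [e / B] in mass, hence [e] in total after
   multiplication by the height [B / N] *)
have h3 : (v - e)%:E <= (B / N%:R)%:E * \sum_(i < N) mu k (U i).
  apply: (@le_trans _ _ ((B / N%:R)%:E * \sum_(i < N) (u i - e / B)%:E)); last first.
    by rewrite lee_pmul2l ?lte_fin//; apply: lee_sum => i _; exact: (ltW (hk i)).
  move: h2; rewrite uE -EFinM lee_fin sumEFin -EFinM lee_fin sumrB sumr_const card_ord mulrBr.
  have -> : (B / N%:R * (e / B *+ N) = e)%R.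
    by rewrite -mulr_natr; field; rewrite pnatr_eq0 -lt0n N0 gt_eqF.
  by move=> h2; rewrite lerD2r.
have h4 : (v - e)%:E <= \int[mu k]_x (f x)%:E + (B / N%:R)%:E by apply: le_trans h1; exact: h3.
apply: (@lt_le_trans _ _ ((v - e)%:E - (B / N%:R)%:E)); last by rewrite leeBlDr.
rewrite -EFinB lte_fin; move: NB; rewrite /e; lra.
Qed.

End portmanteau.

(** * Regularity of finite Borel measures *)

Section finite_measures.
Context d (T : measurableType d) (R : realType).
Local Open Scope ereal_scope.

Section pack.
Variables (m : {measure set T -> \bar R}) (mfin : m setT < +oo).

(** The measure [m] itself; naming it after the proof [mfin] attaches the
finite and sigma-finite structures to a measure whose finiteness is only known
as a hypothesis. *)
Definition fmeas & m setT < +oo := (m : set T -> \bar R).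

HB.instance Definition _ := Measure.on (fmeas mfin).

Let fmeas_fin : fin_num_fun (fmeas mfin).
Proof.
move=> B mB; rewrite ge0_fin_numE ?measure_ge0//.
by apply: le_lt_trans mfin; apply: le_measure; rewrite ?inE.
Qed.

HB.instance Definition _ := Measure_isFinite.Build _ _ _ (fmeas mfin) fmeas_fin.

Definition sfmeas : {sigma_finite_measure set T -> \bar R} := fmeas mfin.

End pack.

Lemma measure_exhaust (m : {measure set T -> \bar R}) (G : nat -> set T) (e : R) :
  m setT < +oo -> (forall k, measurable (G k)) -> nondecreasing_seq G -> (0 < e)%R ->
  exists N, m (\bigcup_k G k `\` G N) <= e%:E.
Proof.
move=> mfin mG ndG e0; set U := \bigcup_k G k.
have mU : measurable U by exact: bigcup_measurable.
have fin B : measurable B -> m B \is a fin_num.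
  move=> mB; rewrite ge0_fin_numE ?measure_ge0//.
  by apply: le_lt_trans mfin; apply: le_measure; rewrite ?inE.
have cv := nondecreasing_cvg_mu (mu := m) mG mU ndG.
have [N hN] : exists N, m U - e%:E < m (G N).
  apply: contrapT => /forallNP h.
  have : m U <= m U - e%:E.
    rewrite -[leLHS](cvg_lim _ cv)//; apply: lime_le; first by apply/cvg_ex; exists (m U).
    by apply: nearW => k; rewrite leNgt; apply/negP; exact: h.
  by rewrite -(fineK (fin _ mU)) -EFinB lee_fin; lra.
exists N; have -> : m (U `\` G N) = m U - m (G N).
  have UG : U `&` G N = G N by apply/setIidr; exact: bigcup_sup.
  rewrite -[in RHS]UG; by apply: measureD => //; rewrite ltey_eq fin.
move: hN; have := fin _ mU; have := fin _ (mG N).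
case: (m (G N)) => [g| |]//; case: (m U) => [u| |]// _ _.
rewrite -!EFinB lte_fin lee_fin; lra.
Qed.

End finite_measures.

Section regularity.
Context {R : realType} {n : nat}.
Notation V := ('rV[R]_n).
Notation X := (borel R n).
Local Open Scope ereal_scope.

Lemma erosion_bigcup (O : set V) : open O -> \bigcup_k erosion O k = O.
Proof.
move=> oO; apply/seteqP; split => [x [k _ /erosion_sub]//|x Ox].
have /nbhs_ballP[e /= e0 eO] : nbhs x O by exact: open_nbhs_nbhs.
have [N _ HN] := near_infty_natSinv_lt (PosNum e0).
exists N => // y xy; apply: eO; apply: le_ball xy.
exact: (ltW (HN N (leqnn N))).
Qed.

Lemma erosion_nd (O : set V) : nondecreasing_seq (erosion O).
Proof.
move=> i j ij; apply/subsetPset => x h y xy; apply: h; apply: le_ball xy.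
by rewrite lef_pV2 ?posrE// ler_nat.
Qed.

Definition approximable (m : {measure set X -> \bar R}) (B : set X) :=
  forall e : R, (0 < e)%R -> exists F O : set V,
    [/\ closed F, open O, F `<=` B, B `<=` O & m (O `\` F) <= e%:E].

Lemma approximable_open (m : {measure set X -> \bar R}) (O : set V) :
  m setT < +oo -> open O -> approximable m O.
Proof.
move=> mfin oO e e0.
have mer k : measurable (erosion O k : set X) by apply: closed_borel; exact: closed_erosion.
have [N] := measure_exhaust mfin mer (@erosion_nd O) e0; rewrite erosion_bigcup// => h.
exists (erosion O N), O; split => //; [exact: closed_erosion|exact: erosion_sub].
Qed.

Lemma approximable_setC (m : {measure set X -> \bar R}) (B : set X) :
  approximable m B -> approximable m (~` B).
Proof.
move=> aB e e0; have [F [U [cF oU FB BU h]]] := aB e e0.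
exists (~` U), (~` F); split.
- exact: open_closedC.
- exact: closed_openC.
- exact: subsetC.
- exact: subsetC.
- by rewrite setDE setCK setIC -setDE.
Qed.

Lemma approximable_bigcup (m : {measure set X -> \bar R}) (B : nat -> set X) :
  m setT < +oo -> (forall k, approximable m (B k)) -> approximable m (\bigcup_k B k).
Proof.
move=> mfin aB e e0.
have e2 : (0 < e / 2)%R by rewrite divr_gt0.
have ek k : (0 < e / 2 / (2 ^ k.+1)%:R)%R by rewrite divr_gt0// ltr0n expn_gt0.
have /choice[F /choice[U HFU]] := fun k => aB k _ (ek k).
have cF k : closed (F k) by have [] := HFU k.
have oU k : open (U k) by have [] := HFU k.
have mF k : measurable (F k : set X) by exact: closed_borel.
have mU k : measurable (U k : set X) by exact: open_borel.
pose G k := \big[setU/set0]_(i < k) F i.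
have cG k : closed (G k) by apply: closed_bigsetU => i _.
have mG k : measurable (G k : set X) by exact: closed_borel.
have GE : \bigcup_k G k = \bigcup_k F k.
  apply/seteqP; split => x [k _]; rewrite /G -?bigcup_mkord.
    by move=> [i _ Fx]; exists i.
  by move=> Fx; exists k.+1 => //; rewrite -bigcup_mkord; exists k => /=.
have ndG : nondecreasing_seq G.
  by move=> i j ij; apply/subsetPset; exact: subset_bigsetU.
have [N hN] := measure_exhaust mfin mG ndG e2.
have mUU : measurable (\bigcup_k U k : set X) by exact: bigcup_measurable.
have mFF : measurable (\bigcup_k F k : set X) by exact: bigcup_measurable.
exists (G N), (\bigcup_k U k); split => //.
- exact: bigcup_open.
- move=> x; rewrite /G -bigcup_mkord => -[i _ Fx]; exists i => //.
  by have [_ _ + _ _] := HFU i; apply.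
- by move=> x [i _ Bx]; exists i => //; have [_ _ _ + _] := HFU i; apply.
apply: (@le_trans _ _ (m (\bigcup_k U k `\` \bigcup_k F k) + m (\bigcup_k G k `\` G N))).
  apply: le_trans (measureU2 _ _ _).
  - apply: le_measure; rewrite ?inE.
    + exact: measurableD.
    + by apply: measurableU; apply: measurableD => //; rewrite GE.
    + move=> x [Ux nGx]; have [Fx|nFx] := pselect ((\bigcup_k F k) x); first by right; rewrite GE.
      by left.
  - exact: measurableD.
  - by apply: measurableD => //; rewrite GE.
rewrite [e]splitr EFinD leeD//.
apply: (@le_trans _ _ (\sum_(k <oo) m (U k `\` F k))).
  apply: measure_sigma_subadditive.
  - by move=> k; exact: measurableD.
  - exact: measurableD.
  - move=> x [[i _ Ux] nF]; exists i => //; split => // Fx; apply: nF; by exists i.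
apply: (@le_trans _ _ (\sum_(k <oo) (e / 2 / (2 ^ k.+1)%:R)%:E)).
  by apply: lee_nneseries => // k _; have [] := HFU k.
exact: (@epsilon_trick0 _ _ xpredT (ltW e2)).
Qed.

(** Approximable sets contain the open sets and form a sigma-algebra. *)
Lemma approximable_borel (m : {measure set X -> \bar R}) (B : set X) :
  m setT < +oo -> measurable B -> approximable m B.
Proof.
move=> mfin; move: B; apply: smallest_sub; last by move=> O; exact: approximable_open.
split.
- by apply: approximable_open => //; exact: open0.
- by move=> A aA; rewrite setTD; exact: approximable_setC.
- by move=> F aF; exact: approximable_bigcup.
Qed.

Definition cball (r : R) : set V := [set x | (`|x| <= r)%R].

Lemma closed_cball r : closed (cball r).
Proof.
rewrite (_ : cball r = (fun x : V => `|x|%R) @^-1` [set y | (y <= r)%R])//.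
by apply: closed_comp; [move=> x _; exact: norm_continuous|exact: closed_le].
Qed.

Lemma compact_cball r : compact (cball r).
Proof.
apply: bounded_closed_compact; last exact: closed_cball.
exists r; split; first exact: num_real.
by move=> s rs x /= xr; rewrite (le_trans xr)// ltW.
Qed.

Lemma cball_bigcup : \bigcup_(k : nat) cball k%:R = setT.
Proof.
apply/seteqP; split => // x _; exists (Num.truncn `|x|).+1 => //.
by apply: ltW; have /andP[] := truncn_itv (normr_ge0 x).
Qed.

Lemma cball_nd : nondecreasing_seq (fun k : nat => cball k%:R).
Proof.
by move=> i j ij; apply/subsetPset => x xi; apply: (le_trans xi); rewrite ler_nat.
Qed.

Lemma inner_regular (m : {measure set X -> \bar R}) (B : set X) (e : R) :
  m setT < +oo -> measurable B -> (0 < e)%R ->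
  exists K : set V, [/\ compact K, K `<=` B & m B <= m K + e%:E].
Proof.
move=> mfin mB e0; have e2 : (0 < e / 2)%R by rewrite divr_gt0.
have [F [U [cF oU FB BU h]]] := approximable_borel mfin mB e2.
have mc k : measurable (cball k%:R : set X) by apply: closed_borel; exact: closed_cball.
have [N hN] := measure_exhaust mfin mc cball_nd e2.
have mF : measurable (F : set X) by exact: closed_borel.
have mU : measurable (U : set X) by exact: open_borel.
exists (F `&` cball N%:R); split.
- by rewrite setIC; apply: compact_closedI => //; exact: compact_cball.
- by move=> x [/FB].
have mK : measurable (F `&` cball N%:R : set X) by exact: measurableI.
apply: (@le_trans _ _ (m (F `&` cball N%:R) + (m (U `\` F) + m (setT `\` cball N%:R)))).
  apply: (@le_trans _ _ (m ((F `&` cball N%:R) `|` ((U `\` F) `|` (setT `\` cball N%:R))))).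
    apply: le_measure; rewrite ?inE//.
      by apply: measurableU => //; apply: measurableU; exact: measurableD.
    move=> x Bx; have [Fx|nFx] := pselect (F x); last by right; left; split => //; exact: BU.
    by have [xN|nxN] := pselect (cball N%:R x); [left|right; right].
  apply: le_trans (measureU2 _ _ _) _ => //.
    by apply: measurableU; exact: measurableD.
  by rewrite leeD2l//; apply: measureU2; exact: measurableD.
by rewrite leeD2l// [e]splitr EFinD leeD//; move: hN; rewrite cball_bigcup.
Qed.

End regularity.

(** * Finite measures as elements of the energy space *)

Section packaging.
Context {R : realType} {n : nat} (alpha : R) (alpha_lt : alpha < n%:R).
Notation X := (borel R n).
Notation sfm := {sigma_finite_measure set X -> \bar R}.
Local Open Scope ereal_scope.
Notation J := (rform alpha).

(** The exponent [alpha - n%:R] is negative, so the integrand is at most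
one. *)
Lemma riesz_tail_fin (m : {measure set X -> \bar R}) : m setT < +oo ->
  \int[m]_(y in [set y | (1 < euclid_norm y)%R]) (euclid_norm y `^ (alpha - n%:R))%:E < +oo.
Proof.
move=> mfin.
have mS : measurable ([set y | (1 < euclid_norm y)%R] : set X).
  have := @euclid_norm_borel R n measurableT _ (measurable_itv `]1%R, +oo[).
  by rewrite setTI (_ : _ @^-1` _ = [set y | (1 < euclid_norm y)%R])//;
    apply/seteqP; split => x /=; rewrite in_itv/= andbT.
have mf : measurable_fun setT (fun y : X => (euclid_norm y `^ (alpha - n%:R))%:E).
  apply/measurable_EFinP.
  exact: (measurableT_comp (measurable_powR _) (@euclid_norm_borel R n)).
apply: (@le_lt_trans _ _ (\int[m]_(y in [set y | (1 < euclid_norm y)%R]) 1)).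
  apply: ge0_le_integral => //.
  - by move=> y _; rewrite lee_fin powR_ge0.
  - exact: measurable_funTS.
  - move=> y /= y1; rewrite lee_fin.
    have h := @ler_powR R _ (ltW y1) (alpha - n%:R)%R 0%R.
    by rewrite powRr0 in h; apply: h; rewrite subr_le0 ltW.
rewrite integral_cst// mul1e; apply: le_lt_trans mfin.
by apply: le_measure; rewrite ?inE.
Qed.

Lemma smeasure_of_pair (p q : sfm) : p setT < +oo -> q setT < +oo ->
  (exists H : set X, [/\ measurable H, p (~` H) = 0 & q H = 0]) ->
  exists mu : smeasure n alpha, spos mu = p /\ sneg mu = q.
Proof.
move=> pfin qfin pq.
have cfin (m : sfm) : m setT < +oo -> forall K : set 'rV[R]_n, compact K -> m K < +oo.
  move=> mfin K cK; apply: le_lt_trans mfin; apply: le_measure; rewrite ?inE//.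
  by apply: closed_borel; exact: compact_closed.
have tail : \int[measure_add p q]_(y in [set y | (1 < euclid_norm y)%R])
    (euclid_norm y `^ (alpha - n%:R))%:E < +oo.
  apply: riesz_tail_fin; rewrite [ltLHS](measure_addE p q setT).
  exact: lte_add_pinfty.
by exists (@SMeasure R n alpha p q (cfin p pfin) (cfin q qfin) pq tail).
Qed.

Lemma energyE (mu : smeasure n alpha) : energy mu =
  J (spos mu) (spos mu) + J (sneg mu) (sneg mu) -
  (J (spos mu) (sneg mu) + J (sneg mu) (spos mu)).
Proof. by rewrite !rformE. Qed.

Lemma energy_positive (mu : smeasure n alpha) : positive_measure mu ->
  energy mu = J (spos mu) (spos mu).
Proof.
by move=> pos; rewrite energyE !(rform_zerol _ _ pos) (rform_zeror _ _ pos) !adde0 sube0.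
Qed.

Lemma signed_value_positive (mu : smeasure n alpha) : positive_measure mu ->
  signed_value mu setT = spos mu setT.
Proof. by move=> pos; rewrite /signed_value (pos setT measurableT) sube0. Qed.

Lemma EplusP (A : set 'rV[R]_n) (mu : smeasure n alpha) : Eplus A mu <->
  [/\ J (spos mu) (spos mu) < +oo, positive_measure mu & (spos mu).-negligible (~` A)].
Proof.
have neg : positive_measure mu ->
    (abs_measure mu).-negligible (~` A) <-> (spos mu).-negligible (~` A).
  move=> pos; have E (B : set X) : measurable B -> abs_measure mu B = spos mu B.
    move=> mB; rewrite [LHS](measure_addE (spos mu) (sneg mu) B).
    by rewrite [X in _ + X](pos B mB) adde0.
  by split => -[B [mB B0 AB]]; exists B; split => //; rewrite -B0 E.
have fin : positive_measure mu -> finite_energy mu <-> J (spos mu) (spos mu) < +oo.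
  by move=> pos; rewrite /finite_energy energy_positive// ge0_fin_numE// rform_ge0.
by split => -[h1 h2 h3]; split => //; first [exact/fin|exact/neg].
Qed.

Lemma Eplus_of (A : set 'rV[R]_n) (m : sfm) : m setT < +oo -> J m m < +oo ->
  m.-negligible (~` A) -> exists mu : smeasure n alpha, Eplus A mu /\ spos mu = m.
Proof.
move=> mfin Jm mA.
have [mu [pE qE]] : exists mu : smeasure n alpha, spos mu = m /\ sneg mu = mzero.
  apply: smeasure_of_pair; [exact: mfin|exact: ltry|exists setT; split => //].
  by rewrite setCT measure0.
exists mu; split => //; apply/EplusP; rewrite pE; split => //.
by move=> B mB; rewrite qE.
Qed.

End packaging.

(** * Mass, energy and capacity *)

Section finite_measure_operations.
Context d (T : measurableType d) (R : realType).
Notation sfm := {sigma_finite_measure set T -> \bar R}.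
Implicit Types m p q : sfm.
Local Open Scope ereal_scope.

Lemma restriction_exists m (D : set T) : m setT < +oo -> measurable D ->
  exists m' : sfm, forall B, m' B = m (B `&` D).
Proof.
move=> mfin mD.
have h : mrestr m mD setT < +oo.
  by apply: le_lt_trans mfin; apply: le_measure; rewrite ?inE//; exact: measurableI.
by exists (sfmeas h).
Qed.

Lemma sum_exists p q : p setT < +oo -> q setT < +oo ->
  exists m' : sfm, forall B, m' B = p B + q B.
Proof.
move=> pfin qfin.
have h : measure_add p q setT < +oo.
  by rewrite [ltLHS](measure_addE p q setT); exact: lte_add_pinfty.
by exists (sfmeas h) => B; exact: (measure_addE p q B).
Qed.

Lemma scale_exists m (r : R) : (0 <= r)%R -> m setT < +oo ->
  exists m' : sfm, forall B, m' B = r%:E * m B.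
Proof.
move=> r0 mfin.
have h : mscale (NngNum r0) m setT < +oo by rewrite /mscale/= lte_mul_pinfty.
by exists (sfmeas h).
Qed.

End finite_measure_operations.

Section mass_and_energy.
Context {R : realType} {n : nat} (alpha : R) (alpha_lt : alpha < n%:R).
Notation X := (borel R n).
Notation sfm := {sigma_finite_measure set X -> \bar R}.
Implicit Types m : sfm.
Local Open Scope ereal_scope.
Notation J := (rform alpha).

Lemma le_measure_setT m (B : set X) : measurable B -> m B <= m setT.
Proof. by move=> mB; apply: le_measure; rewrite ?inE. Qed.

Lemma rform_restriction m m' (D : set X) : m setT < +oo -> measurable D ->
  (forall B, m' B = m (B `&` D)) -> J m' m' <= J m m.
Proof.
move=> mfin mD m'E; have [q qE] := restriction_exists mfin (measurableC mD).
have h B : measurable B -> m B = m' B + q B.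
  move=> mB; rewrite m'E qE -measureU.
  - by rewrite -setIUr setUv setIT.
  - exact: measurableI.
  - by apply: measurableI => //; exact: measurableC.
  - by rewrite setIACA setICr setI0.
exact: le_trans (le_rforml _ _ h) (le_rformr _ _ h).
Qed.

Lemma negligible_full m (A : set 'rV[R]_n) : m.-negligible (~` A) ->
  exists B : set X, [/\ measurable B, B `<=` A & m B = m setT].
Proof.
move=> [N [mN N0 AN]]; exists (~` N); split; first exact: measurableC.
  by rewrite -[A]setCK; exact: subsetC.
have mE : m (N `|` ~` N) = m N + m (~` N).
  by apply: measureU => //; [exact: measurableC|exact: setICr].
by rewrite setUv N0 add0e in mE.
Qed.

Lemma negligible_dominated m m' (A : set 'rV[R]_n) :
  (forall B, measurable B -> m B = 0 -> m' B = 0) ->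
  m.-negligible (~` A) -> m'.-negligible (~` A).
Proof. by move=> h [N [mN N0 AN]]; exists N; split => //; exact: h. Qed.

(** A compact part of [A] carries at least half of the mass, and normalizing
the restriction of [m] to it gives a competitor in the definition of the
capacity of that compact set; the factor 4 comes from squaring that half.
Working with half of the mass avoids a limit. *)
Lemma mass_le_capacity (A : set 'rV[R]_n) (c s j : R) m :
  (0 <= c)%R -> inner_capacity alpha A <= c%:E ->
  m setT = s%:E -> J m m = j%:E -> m.-negligible (~` A) -> (s ^+ 2 <= 4 * c * j)%R.
Proof.
move=> c0 capc ms mj mA.
have s0 : (0 <= s)%R by rewrite -lee_fin -ms measure_ge0.
have j0 : (0 <= j)%R by rewrite -lee_fin -mj rform_ge0.
have mfin : m setT < +oo by rewrite ms ltry.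
have [->|sN0] := eqVneq s 0%R; first by rewrite expr0n/= !mulr_ge0.
have s2 : (0 < s / 2)%R by rewrite divr_gt0// lt_neqAle eq_sym sN0.
(* [A] need not be Borel; a Borel part of it carries [m] *)
have [B [mB BA BT]] := negligible_full mA.
have [K [cK KB hK0]] := inner_regular mfin mB s2.
have hK : m B <= m K + (s / 2)%:E := hK0.
have mK : measurable (K : set X) by apply: closed_borel; exact: compact_closed.
have mKfin : m K \is a fin_num.
  by rewrite ge0_fin_numE ?measure_ge0//; apply: le_lt_trans mfin; exact: le_measure_setT.
pose t := fine (m K); have mKt : m K = t%:E by rewrite fineK.
have t_ge : (s / 2 <= t)%R.
  by move: hK; rewrite BT ms mKt -EFinD lee_fin; lra.
have t0 : (0 < t)%R by exact: lt_le_trans t_ge.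
have ti0 : (0 <= t^-1)%R by rewrite invr_ge0 ltW.
have [q qE] := restriction_exists mfin mK.
have qfin : q setT < +oo by rewrite qE setTI mKt ltry.
have [p pE] := scale_exists ti0 qfin.
have p1 : p setT = 1 by rewrite pE qE setTI mKt -EFinM mulVf// gt_eqF.
have pfin : p setT < +oo by rewrite p1 ltry.
have Jq : J q q <= j%:E by rewrite -mj; exact: rform_restriction qE.
have pEm (D : set X) : measurable D -> p D = t^-1%:E * q D by [].
have Jp : J p p <= (t^-1 * (t^-1 * j))%:E.
  rewrite (rformZl _ _ ti0 pEm) (rformZr _ _ ti0 pEm) !EFinM.
  by do 2 (apply: lee_wpmul2l; first by rewrite lee_fin).
have pK : p.-negligible (~` K).
  exists (~` K); split => //; first exact: measurableC.
  by rewrite pE qE setICl measure0 mule0.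
have [mu [muK muE]] := Eplus_of alpha_lt pfin (le_lt_trans Jp (ltry _)) pK.
have /EplusP[_ mu_pos _] := muK.
have mu1 : Eplus1 K mu by split => //; rewrite signed_value_positive// muE.
pose E := fine (J p p); have JE : J p p = E%:E.
  by rewrite fineK// ge0_fin_numE ?rform_ge0// (le_lt_trans Jp)// ltry.
have E0 : (0 <= E)%R by rewrite -lee_fin -JE rform_ge0.
have : E%:E^-1 <= c%:E.
  apply: le_trans capc; apply: (@le_trans _ _ (capacity alpha K)); last first.
    apply: ereal_sup_ubound; exists K => //; split => //.
    exact: subset_trans BA.
  rewrite /capacity lee_pV2 ?inE.
  - by apply: ereal_inf_lbound; exists mu => //; rewrite energy_positive// muE JE.
  - by rewrite lee_fin.
  - by apply: le_ereal_inf_tmp => _ [nu [/EplusP[_ nu_pos _] _] <-];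
      rewrite energy_positive// rform_ge0.
rewrite inver; case: ifPn => [_|EN0]; first by rewrite leye_eq.
have Ep : (0 < E)%R by rewrite lt_neqAle eq_sym EN0.
rewrite lee_fin => Ec.
have cE : (1 <= c * E)%R by rewrite -ler_pdivrMr// mul1r.
move: Jp; rewrite JE lee_fin => Et.
have ctj : (1 <= c * (t^-1 * (t^-1 * j)))%R by rewrite (le_trans cE)// ler_wpM2l.
have t2 : (t ^+ 2 <= c * j)%R.
  have -> : (c * j = t ^+ 2 * (c * (t^-1 * (t^-1 * j))))%R by field; rewrite gt_eqF.
  by rewrite ler_peMr// sqr_ge0.
have : ((s / 2) ^+ 2 <= t ^+ 2)%R by rewrite lerXn2r// nnegrE ltW.
by rewrite expr_div_n; lra.
Qed.

(** Distances are measured in the sup norm, which is at most the Euclidean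
one. *)
Lemma riesz_far (eta : R) : (0 < eta)%R -> exists2 D : R, (0 < D)%R &
  forall x y : 'rV[R]_n, (D <= `|x - y|)%R -> riesz_kernel alpha x y <= eta%:E.
Proof.
move=> eta0; have an0 : (0 < n%:R - alpha)%R by rewrite subr_gt0.
exists (eta `^ (alpha - n%:R)^-1)%R; first exact: powR_gt0.
move=> x y; set D := (eta `^ _)%R => Dxy.
have D0 : (0 < D)%R by exact: powR_gt0.
have DE : (D <= euclid_norm (x - y))%R by rewrite (le_trans Dxy)// norm_le_euclid.
have E0 : (0 < euclid_norm (x - y))%R by exact: lt_le_trans DE.
rewrite riesz_kernelE gt_eqF// lee_fin.
have -> : eta = (D `^ (alpha - n%:R))%R.
  by rewrite -powRrM mulVf ?powRr1 ?ltW// subr_eq0 lt_eqF.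
rewrite -[(alpha - n%:R)%R]opprB !powRN lef_pV2 ?posrE ?powR_gt0//.
by apply: ge0_ler_powR => //; rewrite ?nnegrE ltW.
Qed.

Lemma rform_far (p q : sfm) (S T : set X) (eta : R) :
  (0 <= eta)%R -> measurable S -> measurable T -> p (~` S) = 0 -> q (~` T) = 0 ->
  (forall x y, S x -> T y -> riesz_kernel alpha x y <= eta%:E) ->
  J p q <= eta%:E * q setT * p setT.
Proof.
move=> eta0 mS mT pS qT far.
rewrite rform_rpot -integral_cst//.
apply: ae_ge0_le_integral => //.
- by move=> x _; exact: rpot_ge0.
- exact: rpot_borel.
- by move=> x _; rewrite mule_ge0.
exists (~` S); split => //; first exact: measurableC.
move=> x /= h Sx; apply: h => _; rewrite rpotE -integral_cst//.
apply: ae_ge0_le_integral => //.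
- by move=> y _; exact: riesz_kernel_ge0.
- have mg : measurable_fun setT (fun y : X => ((x, y) : X * X)) by exact: measurable_fun_pair.
  exact: (measurableT_comp (@riesz_kernel_borel R n alpha) mg).
exists (~` T); split => //; first exact: measurableC.
by move=> y /= h' Ty; apply: h' => _; exact: far.
Qed.

End mass_and_energy.

(** * Tightness from finite capacity *)

Section tightness.
Context {R : realType} {n : nat} (alpha : R) (alpha_lt : alpha < n%:R).
Notation X := (borel R n).
Notation sfm := {sigma_finite_measure set X -> \bar R}.
Implicit Types m : sfm.
Local Open Scope ereal_scope.
Notation J := (rform alpha).
Variables (A : set 'rV[R]_n) (c M e : R).
Hypotheses (c0 : (0 <= c)%R) (capc : inner_capacity alpha A <= c%:E) (e0 : (0 < e)%R).

Let cb (r : R) : set X := @cball R n r.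

Let mcb r : measurable (cb r).
Proof. by apply: closed_borel; exact: closed_cball. Qed.

Let mcbC r : measurable (~` cb r).
Proof. exact: measurableC. Qed.

(** At most half of the escaping mass [e] is given up to make the piece
bounded, so that a further piece can be placed away from it. *)
Lemma distant_piece m (r : R) : m setT = 1 -> e%:E < m (~` cb r) ->
  exists (q : sfm) (k : R), [/\ forall B, measurable B -> m B = 0 -> q B = 0,
    J q q <= J m m, (e / 2)%:E <= q setT <= 1, q (cb r) = 0 & q (~` cb k) = 0].
Proof.
move=> m1 hm; have mfin : m setT < +oo by rewrite m1 ltry.
pose G (k : nat) : set X := cb k%:R `\` cb r.
have mG k : measurable (G k) by exact: measurableD.
have ndG : nondecreasing_seq G.
  move=> i j ij; apply/subsetPset => x [xi xr]; split => //.
  by have /subsetPset := @cball_nd R n _ _ ij; apply.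
have GU : \bigcup_k G k = ~` cb r.
  apply/seteqP; split => [x [k _ []]//|x xr].
  have : (\bigcup_(k : nat) @cball R n k%:R) x by rewrite cball_bigcup.
  by move=> [k _ xk]; exists k.
have e2 : (0 < e / 2)%R by rewrite divr_gt0.
have [k] := measure_exhaust mfin mG ndG e2; rewrite GU => hk0.
have hk : m (~` cb r `\` G k) <= (e / 2)%:E := hk0.
have [q qE] := restriction_exists mfin (mG k).
have qT : q setT = m (G k) by rewrite qE setTI.
exists q, k%:R; split.
- move=> B mB mB0; rewrite qE; apply: (subset_measure0 (B := B)) => //.
  exact: measurableI.
- exact: rform_restriction qE.
- rewrite qT; apply/andP; split; last by rewrite -m1; exact: le_measure_setT.
  have hs : m (~` cb r) <= m (~` cb r `\` G k) + m (G k).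
    apply: le_trans (measureU2 _ _ _) => //; last exact: measurableD.
    apply: le_measure; rewrite ?inE//.
      by apply: measurableU => //; exact: measurableD.
    by move=> x xr; have [Gx|nGx] := pselect (G k x); [right|left].
  have mGfin : m (G k) \is a fin_num.
    by rewrite ge0_fin_numE ?measure_ge0// (le_lt_trans (le_measure_setT _ _)).
  have : e%:E < (e / 2)%:E + m (G k).
    by apply: lt_le_trans hm _; apply: le_trans hs _; rewrite leeD2r.
  by rewrite -(fineK mGfin) -EFinD lte_fin lee_fin; lra.
- by rewrite qE (_ : _ `&` _ = set0)// /G; apply/seteqP; split => // x [xr [_ ]].
- by rewrite qE (_ : _ `&` _ = set0)// /G; apply/seteqP; split => // x [xr []].
Qed.

Hypothesis escape : forall r, exists m, [/\ m setT = 1, J m m <= M%:E,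
  m.-negligible (~` A) & e%:E < m (~` cb r)].

(** Each new piece is placed at distance at least [D] from the sum of the
previous ones, where the kernel is below [eta]. The energies of the pieces add
up to at most [N%:R * M] and the mutual energies to at most
[N%:R ^+ 2 * eta]. *)
Lemma spread_out_sum (eta : R) (N : nat) : (0 < eta)%R ->
  exists (p : sfm) (r : R), [/\ p (~` cb r) = 0, p.-negligible (~` A),
    (N%:R * (e / 2))%:E <= p setT <= N%:R%:E &
    J p p <= (N%:R * M + N%:R ^+ 2 * eta)%:E].
Proof.
move=> eta0; have [D D0 far] := riesz_far alpha_lt eta0.
elim: N => [|N [p [r [pr pA /andP[p_ge p_le] Jp]]]].
  exists mzero, 0%R; split => //.
  - by exists setT; split.
  - by rewrite mul0r lexx.
  - by rewrite rform_zerol// lee_fin mul0r add0r expr0n/= mul0r.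
have [m [m1 Jm mA hm]] := escape (r + D).
have [q [k [qm Jq /andP[q_ge q_le] qr qk]]] := distant_piece m1 hm.
have pfin : p setT < +oo by apply: le_lt_trans p_le _; exact: ltry.
have qfin : q setT < +oo by apply: le_lt_trans q_le _; exact: ltry.
have [s sE] := sum_exists pfin qfin.
have sEm B : measurable B -> s B = p B + q B by [].
have cb_sub a b : (a <= b)%R -> ~` cb b `<=` ~` cb a.
  by move=> ab; apply: subsetC => x xa; exact: le_trans ab.
exists s, (Num.max r k); split.
- rewrite sE (subset_measure0 _ _ (cb_sub r _ _) pr)// ?le_max ?lexx//.
  by rewrite (subset_measure0 _ _ (cb_sub k _ _) qk)// ?le_max ?lexx ?orbT// adde0.
- have [B1 [mB1 B10 AB1]] := pA; have [B2 [mB2 B20 AB2]] := negligible_dominated qm mA.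
  exists (B1 `&` B2); split; first exact: measurableI.
    rewrite sE (subset_measure0 _ mB1 (@subIsetl _ _ _) B10)//; last exact: measurableI.
    by rewrite (subset_measure0 _ mB2 (@subIsetr _ _ _) B20)// ?adde0//; exact: measurableI.
  by move=> x Ax; split; [exact: AB1|exact: AB2].
- rewrite sE -natr1 mulrDl mul1r !EFinD; apply/andP; split; exact: leeD.
- have Jpq : J p q <= (eta * N%:R)%:E.
    have p0 : p (~` cb r) = 0 := pr.
    have q0 : q (~` ~` cb (r + D)) = 0 by rewrite setCK.
    have := rform_far (ltW eta0) (mcb r) (mcbC (r + D)) p0 q0 _.
    move=> /(_ alpha) h; apply: le_trans (h _) _.
      move=> x y xr yr; apply: far.
      rewrite -(lerD2r `|x : 'rV[R]_n|%R); apply: (@le_trans _ _ `|y : 'rV[R]_n|%R).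
        apply: (@le_trans _ _ (r + D)%R); first by rewrite addrC lerD2r.
        by rewrite leNgt; apply/negP => /ltW /yr.
      by rewrite distrC (le_trans _ (ler_normD _ _))// subrK.
    rewrite EFinM; apply: lee_pmul => //; first by rewrite mule_ge0// lee_fin ltW.
    rewrite -[leRHS]mule1; apply: lee_wpmul2l => //; rewrite lee_fin; exact: ltW.
  rewrite (rformDl _ _ sEm) !(rformDr _ _ sEm) (rformC _ q p).
  have Jqq : J q q <= M%:E by exact: le_trans Jm.
  apply: le_trans (leeD (leeD Jp Jpq) (leeD Jpq Jqq)) _.
  by rewrite -!EFinD lee_fin -natr1; nra.
Qed.

(** The quadratic lower bound on the energy provided by finite capacity beats
the linear term for large [N], provided [eta] is small against
[e ^+ 2 / c]. *)
Lemma no_escape : False.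
Proof.
have [m [m1 Jm _ _]] := escape 0%R.
have M0 : (0 <= M)%R by rewrite -lee_fin; exact: le_trans (rform_ge0 _ _ _) Jm.
have c32 : (0 < 32 * (c + 1))%R by rewrite mulr_gt0// ltr_wpDl.
have eta0 : (0 < e ^+ 2 / (32 * (c + 1)))%R by rewrite divr_gt0// exprn_gt0.
(* with this [eta] the mutual energies, multiplied by [4 * c], account for at most
   half of the squared mass [(N * e / 2) ^+ 2]; adding 1 to [c] only keeps the
   denominator positive *)
set eta := (e ^+ 2 / (32 * (c + 1)))%R in eta0.
have etaE : (eta * (32 * (c + 1)) = e ^+ 2)%R by rewrite /eta divfK// gt_eqF.
pose N := (Num.truncn (32 * c * M / e ^+ 2)).+1.
have Ne : (32 * c * M < N%:R * e ^+ 2)%R.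
  rewrite -ltr_pdivrMr ?exprn_gt0//.
  have : (0 <= 32 * c * M / e ^+ 2)%R by rewrite divr_ge0 ?sqr_ge0// !mulr_ge0.
  by move=> /truncn_itv/andP[].
have [p [r [_ pA /andP[p_ge p_le] Jp]]] := spread_out_sum N eta0.
have pE : p setT = (fine (p setT))%:E.
  by rewrite fineK// ge0_fin_numE// (le_lt_trans p_le)// ltry.
have JE : J p p = (fine (J p p))%:E.
  by rewrite fineK// ge0_fin_numE ?rform_ge0// (le_lt_trans Jp)// ltry.
have := mass_le_capacity alpha_lt c0 capc pE JE pA.
move: p_ge Jp; rewrite pE JE !lee_fin /=.
set s := fine (p setT); set j := fine (J p p); move=> sN jN sj.
have N0 : (0 < N%:R :> R)%R by rewrite ltr0n.
have h1 : ((N%:R * (e / 2)) ^+ 2 <= s ^+ 2)%R.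
  have Ne0 : (0 <= N%:R * (e / 2))%R by rewrite mulr_ge0 ?divr_ge0// ltW.
  by rewrite lerXn2r// nnegrE// (le_trans Ne0).
have h2 : (4 * c * j <= 4 * c * (N%:R * M + N%:R ^+ 2 * eta))%R by rewrite ler_wpM2l// mulr_ge0.
have h3 : (4 * c * (N%:R ^+ 2 * eta) <= N%:R ^+ 2 * (e ^+ 2 / 8))%R.
  rewrite -etaE; have : (0 <= N%:R ^+ 2 * eta)%R by rewrite mulr_ge0 ?exprn_ge0// ltW.
  nra.
have h4 : (N%:R * (N%:R * e ^+ 2) <= N%:R * (32 * c * M))%R.
  have -> : (N%:R * (N%:R * e ^+ 2) = 8 * (N%:R * (e / 2)) ^+ 2 - N%:R ^+ 2 * e ^+ 2)%R by field.
  nra.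
by move: h4; rewrite ler_pM2l// leNgt Ne.
Qed.

End tightness.

Lemma uniformly_tight (R : realType) (n : nat) (alpha : R) (A : set 'rV[R]_n) (M e : R) :
  alpha < n%:R -> (inner_capacity alpha A < +oo)%E -> 0 < e ->
  exists r : R, forall m : {sigma_finite_measure set (borel R n) -> \bar R},
    m setT = 1%E -> (rform alpha m m <= M%:E)%E -> m.-negligible (~` A) ->
    (m (~` @cball R n r) <= e%:E)%E.
Proof.
move=> alpha_lt capA e0.
have [c c0 capc] : exists2 c : R, 0 <= c & (inner_capacity alpha A <= c%:E)%E.
  case: (inner_capacity alpha A) capA => [x _| |_]//; last by exists 0; rewrite ?leNye.
  by exists `|x|; rewrite // lee_fin ler_norm.
apply: contrapT => /forallNP h.
apply: (no_escape alpha_lt (M := M) c0 capc e0) => r.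
have /existsNP[m /not_implyP[m1 /not_implyP[Jm /not_implyP[mA /negP]]]] := h r.
by rewrite -ltNge => hm; exists m.
Qed.

(** * Differences of measures and continuity of the energy form *)

Section measure_difference.
Context d (T : measurableType d) (R : realType).
Notation sfm := {sigma_finite_measure set T -> \bar R}.
Local Open Scope ereal_scope.

(** The Jordan decomposition of [p - q], written through the mass that [p] and
[q] have on both sides of a Hahn set, so that no subtraction is needed. *)
Lemma hahn_difference (p q : sfm) : p setT < +oo -> q setT < +oo ->
  exists (P : set T) (dp dq : sfm), [/\ measurable P, dp (~` P) = 0 /\ dq P = 0,
    dp setT < +oo /\ dq setT < +oo,
    forall B, measurable B -> p (B `&` P) = dp B + q (B `&` P) &
    forall B, measurable B -> q (B `&` ~` P) = dq B + p (B `&` ~` P)].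
Proof.
move=> pfin qfin.
pose cp : {charge set T -> \bar R} := charge_of_finite_measure (fmeas pfin).
pose cq : {charge set T -> \bar R} := charge_of_finite_measure (fmeas qfin).
pose nu : {charge set T -> \bar R} := cadd cp (copp cq).
have [P [N nuPN]] := Hahn_decomposition nu.
have [[mP _] [mN _] PN0 PNI] := nuPN.
have NE : N = ~` P.
  apply/seteqP; split => x.
    by move=> Nx Px; have : (P `&` N) x by []; rewrite PNI.
  by move=> nPx; have [//|//] : (P `|` N) x by rewrite PN0.
have fin (m : sfm) B : m setT < +oo -> measurable B -> m B \is a fin_num.
  move=> mfin mB; rewrite ge0_fin_numE ?measure_ge0//; apply: le_lt_trans mfin.
  by apply: le_measure; rewrite ?inE.
have nuE B : nu B = p B - q B by [].
pose dp : sfm := jordan_pos nuPN.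
pose dq : sfm := jordan_neg nuPN.
have dpE B : measurable B -> dp B = p (B `&` P) - q (B `&` P).
  move=> mB; rewrite -nuE.
  have -> : dp B = crestr0 nu mP B by rewrite [LHS]jordan_posE cjordan_posE.
  by rewrite /crestr0 mem_set.
have dqE B : measurable B -> dq B = - (p (B `&` N) - q (B `&` N)).
  move=> mB; rewrite -nuE.
  have -> : dq B = - crestr0 nu mN B by rewrite [LHS]jordan_negE cjordan_negE.
  by rewrite /crestr0 mem_set.
exists P, dp, dq; split => //.
- split; first by rewrite dpE ?setICl ?measure0 ?sube0//; exact: measurableC.
  by rewrite dqE// NE setICr !measure0 sube0 oppe0.
- split; first by rewrite dpE// ltey_eq fin_numB !fin//; exact: measurableI.
  by rewrite dqE// ltey_eq fin_numN fin_numB !fin//; exact: measurableI.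
- by move=> B mB; rewrite dpE// subeK// fin//; exact: measurableI.
- move=> B mB; have mBP : measurable (B `&` ~` P).
    by apply: measurableI => //; exact: measurableC.
  by rewrite dqE// NE fin_num_oppeB ?fin// [X in X + _]addeC subeK// fin.
Qed.

End measure_difference.

Section strong_topology.
Context {R : realType} {n : nat} (alpha : R) (alpha_lt : alpha < n%:R).
Notation X := (borel R n).
Notation sfm := {sigma_finite_measure set X -> \bar R}.
Implicit Types m p q a b c : sfm.
Local Open Scope ereal_scope.
Notation J := (rform alpha).

Lemma rform_fin p q : J p p < +oo -> J q q < +oo -> J p q \is a fin_num.
Proof. by move=> hp hq; rewrite ge0_fin_numE ?rform_ge0//; exact: rform_lty. Qed.

(** On the Hahn set [p] is the positive part plus a piece of [q], off it [q]
is the negative part plus a piece of [p]. The parts are thus dominated by [p]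
and [q] and have finite energy, and bilinearity gives the energy of the
difference. *)
Lemma difference_exists p q : p setT < +oo -> q setT < +oo ->
  J p p < +oo -> J q q < +oo -> exists delta : smeasure n alpha,
  [/\ forall B : set X, measurable B -> signed_value delta B = p B - q B,
      finite_energy delta & energy delta = J p p + J q q - 2%:E * J p q].
Proof.
move=> pfin qfin Jp Jq.
have [P [dp [dq [mP [dpP dqP] [dpfin dqfin] pE qE]]]] := hahn_difference pfin qfin.
have mPC : measurable (~` P) by exact: measurableC.
have [delta [dE1 dE2]] : exists delta : smeasure n alpha, spos delta = dp /\ sneg delta = dq.
  by apply: smeasure_of_pair => //; exists P.
have [p1 p1E] := restriction_exists pfin mP.
have [p2 p2E] := restriction_exists pfin mPC.
have [q1 q1E] := restriction_exists qfin mP.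
have [q2 q2E] := restriction_exists qfin mPC.
have split_P m B : measurable B -> m B = m (B `&` P) + m (B `&` ~` P).
  move=> mB; rewrite -measureU; first by rewrite -setIUr setUv setIT.
  - exact: measurableI.
  - exact: measurableI.
  - by rewrite setIACA setICr setI0.
have pD B : measurable B -> p B = p1 B + p2 B by move=> mB; rewrite p1E p2E split_P.
have qD B : measurable B -> q B = q1 B + q2 B by move=> mB; rewrite q1E q2E split_P.
have p1D B : measurable B -> p1 B = dp B + q1 B by move=> mB; rewrite p1E q1E pE.
have q2D B : measurable B -> q2 B = dq B + p2 B by move=> mB; rewrite q2E p2E qE.
have Jdp : J dp dp < +oo.
  apply: (@le_lt_trans _ _ (J p1 p1)); first exact: le_trans (le_rforml _ _ p1D) (le_rformr _ _ p1D).
  by apply: le_lt_trans Jp; exact: le_trans (le_rforml _ _ pD) (le_rformr _ _ pD).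
have qD' B : measurable B -> q B = q2 B + q1 B by move=> mB; rewrite addeC qD.
have Jdq : J dq dq < +oo.
  apply: (@le_lt_trans _ _ (J q2 q2)); first exact: le_trans (le_rforml _ _ q2D) (le_rformr _ _ q2D).
  by apply: le_lt_trans Jq; exact: le_trans (le_rforml _ _ qD') (le_rformr _ _ qD').
(* [p - q = dp - dq] without subtraction, tested against an arbitrary [m] *)
have swap m : J dp m + J q m = J dq m + J p m.
  rewrite (rformDl _ _ qD) (rformDl _ _ pD) (rformDl _ _ p1D) (rformDl _ _ q2D).
  rewrite !addeA [J dq m + J dp m]addeC.
  by rewrite [J dp m + J dq m + J q1 m]addeAC.
exists delta; split.
- move=> B mB; rewrite /signed_value dE1 dE2.
  have fin m : m setT < +oo -> forall D : set X, measurable D -> m D \is a fin_num.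
    by move=> mfin D mD; rewrite ge0_fin_numE ?measure_ge0// (le_lt_trans (le_measure_setT _ mD)).
  rewrite (split_P p)// (split_P q)// pE// qE//.
  have mBP : measurable (B `&` ~` P) by exact: measurableI.
  have mBP' : measurable (B `&` P) by exact: measurableI.
  move: (fin _ dpfin _ mB) (fin _ dqfin _ mB) (fin _ qfin _ mBP') (fin _ pfin _ mBP).
  case: (dp B) => // x _; case: (dq B) => // y _.
  case: (q (B `&` P)) => // z _; case: (p (B `&` ~` P)) => // w _.
  by rewrite /adde/= ; congr EFin; ring.
- rewrite /finite_energy energyE dE1 dE2.
  by rewrite fin_numB !fin_numD !rform_fin.
- rewrite energyE dE1 dE2.
  move: (swap dp) (swap dq) (swap p) (swap q).
  rewrite (rformC _ dq dp) (rformC _ q dp) (rformC _ p dp) (rformC _ q dq) (rformC _ p dq) (rformC _ q p).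
  rewrite -(fineK (rform_fin Jdp Jdp)) -(fineK (rform_fin Jdq Jdq)) -(fineK (rform_fin Jdp Jdq)).
  rewrite -(fineK (rform_fin Jdp Jp)) -(fineK (rform_fin Jdp Jq)) -(fineK (rform_fin Jdq Jp)).
  rewrite -(fineK (rform_fin Jdq Jq)) -(fineK (rform_fin Jp Jp)) -(fineK (rform_fin Jq Jq)).
  rewrite -(fineK (rform_fin Jp Jq)) -!EFinM -!EFinD.
  by move=> [h1] [h2] [h3] [h4]; congr EFin; lra.
Qed.

(** The strong distance between [a] and [b] is at most the square root of [x].
The Cauchy-Schwarz bound is stated with a free parameter [t], as the mean of
squares instead of their geometric mean. *)
Lemma rform_continuity a b c (x t : R) : (0 < t)%R ->
  J a a < +oo -> J b b < +oo -> J c c < +oo ->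
  J a a + J b b <= 2%:E * J a b + x%:E ->
  (`|fine (J a c) - fine (J b c)| <= x / (2 * t) + t * fine (J c c) / 2)%R.
Proof.
move=> t0 ha hb hc hx.
have := rform_three_term alpha_lt a b c t0; have := rform_three_term alpha_lt b a c t0.
rewrite (rformC _ b a) (rformC _ c a) (rformC _ c b); move: hx.
rewrite -(fineK (rform_fin ha ha)) -(fineK (rform_fin hb hb)) -(fineK (rform_fin ha hb)).
rewrite -(fineK (rform_fin ha hc)) -(fineK (rform_fin hb hc)) -(fineK (rform_fin hc hc)) /=.
rewrite -!EFinM -!EFinD !lee_fin => h1 h2 h3.
set u := fine (J a c) in h2 h3 *; set v := fine (J b c) in h2 h3 *.
set w := fine (J c c) in h2 h3 *.
(* the two sides of the absolute value come from the three-term inequality with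
   [a] and [b] exchanged; both are cleared of the denominator [2 * t] *)
have E : ((2 * t) * (x / (2 * t) + t * w / 2) = x + t ^+ 2 * w)%R.
  by field; rewrite gt_eqF.
have t2 : (0 < 2 * t)%R by rewrite mulr_gt0.
by rewrite ler_norml; apply/andP; split; rewrite -(ler_pM2l t2) ?mulrN E mulrBr; lra.
Qed.

End strong_topology.

(** * Limits of Cauchy sequences of unit measures *)

Section geometric_errors.
Context {R : realType}.
Notation half := (2^-1 : R).

Lemma half_small (e : R) : 0 < e -> exists N, forall j, (N <= j)%N -> half ^+ j < e.
Proof.
move=> e0; have h1 : `|half| < 1 by rewrite ger0_norm; lra.
have := cvg_expr h1 => /cvgrPdist_lt /(_ _ e0) [N _ HN]; exists N => j Nj.
by have := HN j Nj; rewrite sub0r normrN ger0_norm// exprn_ge0//; lra.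
Qed.

Lemma half_sum (a : R) j : 0 <= a ->
  (\sum_(0 <= i <oo) (2 ^+ i.+1 * (a * (half ^+ (j + i)) ^+ 2))%:E <= (4 * a * (half ^+ j) ^+ 2)%:E)%E.
Proof.
move=> a0; have x0 : 0 <= 4 * a * (half ^+ j) ^+ 2 by rewrite !mulr_ge0// exprn_ge0//; lra.
apply: le_trans (@epsilon_trick0 _ _ xpredT x0).
apply: lee_nneseries => i _ //.
  by rewrite lee_fin mulr_ge0 ?exprn_ge0// mulr_ge0// sqr_ge0.
rewrite lee_fin natrX exprD !exprVn exprS; rewrite le_eqVlt; apply/predU1l; field.
by rewrite !expf_neq0// pnatr_eq0.
Qed.

End geometric_errors.

Lemma integral_complement d (T : measurableType d) (R : realType)
    (m : {measure set T -> \bar R}) (f : T -> R) (B : R) :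
  m setT = 1%E -> measurable_fun setT f -> (forall x, 0 <= f x <= B) ->
  (\int[m]_x (f x)%:E)%E \is a fin_num /\
  (\int[m]_x (B - f x)%:E = (B - fine (\int[m]_x (f x)%:E))%:E)%E.
Proof.
move=> m1 mf fB; have B0 : 0 <= B by have /andP[h /(le_trans h)] := fB point.
have mg : measurable_fun setT (fun x => (B - f x)%:E) by apply/measurable_EFinP; exact: measurable_funB.
have cB : (\int[m]_x (B%:E) = B%:E)%E by rewrite integral_cst// m1 mule1.
have f0 x : (0 <= (f x)%:E)%E by rewrite lee_fin; have /andP[] := fB x.
have g0 x : (0 <= (B - f x)%:E)%E by rewrite lee_fin subr_ge0; have /andP[] := fB x.
have mfE : measurable_fun setT (fun x => (f x)%:E) by exact/measurable_EFinP.
have fin : (\int[m]_x (f x)%:E)%E \is a fin_num.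
  rewrite ge0_fin_numE ?integral_ge0//; apply: (@le_lt_trans _ _ B%:E); last exact: ltry.
  rewrite -cB; apply: ge0_le_integral => // x _.
  by rewrite lee_fin; have /andP[] := fB x.
split => //; have : (\int[m]_x (B - f x)%:E + \int[m]_x (f x)%:E = B%:E)%E.
  rewrite -ge0_integralD// -cB; apply: eq_integral => x _; by rewrite -EFinD subrK.
move: fin; case: (\int[m]_x (f x)%:E)%E => [s| |]// _.
by case: (\int[m]_x _)%E => [t| |]//= -[] <-; rewrite addrK.
Qed.

Section limit_of_cauchy_sequence.
Context {R : realType} {n : nat} (alpha : R) (alpha_lt : alpha < n%:R) (A : set 'rV[R]_n).
Hypotheses (capA_fin : (inner_capacity alpha A < +oo)%E)
  (closedA : strongly_closed (@Eplus R n alpha A)).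
Notation X := (borel R n).
Notation sfm := {sigma_finite_measure set X -> \bar R}.
Local Open Scope ereal_scope.
Notation J := (rform alpha).
Notation half := (2^-1 : R)%R.

Definition admissible (m : sfm) := [/\ m setT = 1, J m m < +oo & m.-negligible (~` A)].

Lemma admissible_lty m : admissible m -> m setT < +oo.
Proof. by move=> [-> _ _]; exact: ltry. Qed.

(** A bounded continuous function and its complement to [B] are both lower
semicontinuous, so [portmanteau_lsc] bounds the integrals from both sides. *)
Lemma portmanteau_continuous (mu : nat -> sfm) (m : sfm) (F : set_system nat) {FF : ProperFilter F}
    (f : 'rV[R]_n -> R) (B eps : R) (N : nat) :
  \oo `<=` F -> (forall k, mu k setT = 1) -> m setT = 1 ->
  (forall (O : set 'rV[R]_n) (r : R), open O -> r%:E < m O -> F [set k | r%:E < mu k O]) ->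
  continuous f -> (forall x, 0 <= f x <= B)%R -> (0 < eps)%R ->
  exists2 k, (N <= k)%N &
    (`|fine (\int[mu k]_x (f x)%:E) - fine (\int[m]_x (f x)%:E)| <= eps)%R.
Proof.
move=> ooF mu1 m1 cvO cf fB eps0.
have mf : measurable_fun setT (f : X -> R) by exact: continuous_borel.
have [fin cm] := integral_complement m1 mf fB.
have hk k := integral_complement (mu1 k) mf fB.
have of1 (a : R) : open [set x | (a < f x)%R].
  rewrite (_ : [set _ | _] = f @^-1` [set y | (a < y)%R])//.
  by apply: open_comp; [move=> x _; exact: cf|exact: open_gt].
have of2 (a : R) : open [set x | (a < B - f x)%R].
  rewrite (_ : [set _ | _] = f @^-1` [set y | (y < B - a)%R]).
    by apply: open_comp; [move=> x _; exact: cf|exact: open_lt].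
  by apply/seteqP; split => x /=; rewrite ltrBrDr -ltrBrDl.
have gB x : (0 <= B - f x <= B)%R by have /andP[? ?] := fB x; apply/andP; split; lra.
set I := fine (\int[m]_x (f x)%:E).
have IE : \int[m]_x (f x)%:E = I%:E by rewrite /I fineK.
have F1 := @portmanteau_lsc _ _ mu m F _ f B mu1 m1 cvO of1 fB (I - eps)%R.
have F2 := @portmanteau_lsc _ _ mu m F _ (fun x => B - f x)%R B mu1 m1 cvO of2 gB (B - I - eps)%R.
have {}F1 : F [set k | (I - eps)%:E < \int[mu k]_x (f x)%:E] by apply: F1; rewrite IE lte_fin; lra.
have {}F2 : F [set k | (B - I - eps)%:E < \int[mu k]_x (B - f x)%:E].
  by apply: F2; rewrite cm lte_fin -/I; lra.
have F3 : F [set k | (N <= k)%N] by apply: ooF; exists N.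
have [k [[/= k1 k2] k3]] := filter_ex (filterI (filterI F1 F2) F3).
exists k => //; have [kfin kc] := hk k; move: k1 k2; rewrite kc -(fineK kfin) !lte_fin.
by rewrite ler_norml => h1 h2; apply/andP; split; lra.
Qed.

(** Bounded energy gives tightness, hence a weak cluster point [m]; the
features are integrals of bounded continuous functions, so they cluster at
those of [m], and [strong_limit_features] makes the convergence strong. Strong
closedness is then applied to differences [m - mu N] to see that [m] is
carried by [A]. *)
Lemma cauchy_limit (mu : nat -> sfm) : (forall k, admissible (mu k)) ->
  (forall j k, J (mu j) (mu j) + J (mu k) (mu k) <=
     2%:E * J (mu j) (mu k) + (2 * ((half ^+ j) ^+ 2 + (half ^+ k) ^+ 2))%:E) ->
  exists (m : sfm) (F : set_system nat),
  [/\ ProperFilter F /\ \oo `<=` F, admissible m,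
      forall (O : set 'rV[R]_n) (r : R), open O -> r%:E < m O -> F [set k | r%:E < mu k O] &
      forall j, J (mu j) (mu j) + J m m <= 2%:E * J (mu j) m + (16 * (half ^+ j) ^+ 2)%:E].
Proof.
move=> adm cauchy.
have mu1 k : mu k setT = 1 by have [] := adm k.
have mufin k : mu k setT < +oo by exact: admissible_lty.
have muJ k : J (mu k) (mu k) < +oo by have [] := adm k.
have muN k : (mu k).-negligible (~` A) by have [] := adm k.
have h01 k : (0 <= half ^+ k <= 1)%R by rewrite exprn_ge0 ?exprn_ile1//=; lra.
have Jbound k : J (mu k) (mu k) <= (2 * fine (J (mu 0%N) (mu 0%N)) + 8)%:E.
  (* the zero measure and [t = 2] give
     [4 * J (mu k) (mu 0) <= 4 * J (mu 0) (mu 0) + J (mu k) (mu k)] *)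
  have := cauchy k 0%N; have := rform_three_term alpha_lt mzero (mu k) (mu 0%N) (ltr0n R 2).
  rewrite (@rform_zerol _ _ _ mzero mzero)// (@rform_zerol _ _ _ mzero (mu k))//.
  rewrite (@rform_zerol _ _ _ mzero (mu 0%N))// !mule0 !add0e (rformC _ (mu 0%N) (mu k)).
  rewrite -(fineK (rform_fin alpha_lt (muJ k) (muJ k))) -(fineK (rform_fin alpha_lt (muJ k) (muJ 0%N))).
  rewrite -(fineK (rform_fin alpha_lt (muJ 0%N) (muJ 0%N))) -!EFinM -!EFinD !lee_fin /= expr0.
  have /andP[? ?] := h01 k; have : ((half ^+ k) ^+ 2 <= 1)%R by rewrite exprn_ile1.
  by lra.
have tight (e : R) : (0 < e)%R -> exists2 K : set 'rV[R]_n, compact K &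
    forall k, mu k (~` K) <= e%:E.
  move=> e0; have [r Hr] := uniformly_tight (2 * fine (J (mu 0%N) (mu 0%N)) + 8)%R alpha_lt capA_fin e0.
  by exists (cball r); [exact: compact_cball|move=> k; exact: Hr].
have [m0 [F [FU ooF m01 cvO]]] := weak_cluster_exists (mu := mu) mu1 tight.
have m0fin : m0 setT < +oo by rewrite m01 ltry.
pose m : sfm := sfmeas m0fin.
have FF : ProperFilter F by case: FU.
have m1 : m setT = 1 by [].
have mfin : m setT < +oo by [].
have {}cvO (O : set 'rV[R]_n) (r : R) : open O -> r%:E < m O -> F [set k | r%:E < mu k O].
  exact: cvO.
have [c [d [Z [rho [H [c0 mH cH bH rH]]]]]] := riesz_features alpha_lt.
pose e k := (4 * (half ^+ k) ^+ 2)%R.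
(* [4] absorbs the error [2 * (4^-k + 4^-(k+1))] of consecutive terms *)
have e0 k : (0 <= e k)%R by rewrite mulr_ge0// sqr_ge0.
have Hc k : J (mu k) (mu k) + J (mu k.+1) (mu k.+1) <= 2%:E * J (mu k) (mu k.+1) + (e k)%:E.
  apply: le_trans (cauchy k k.+1) _; rewrite leeD2l// lee_fin /e.
  have /andP[h0 h1] := h01 k.
  by rewrite [in X in (X <= _)%R](exprS half k) exprMn; have := sqr_ge0 (half ^+ k)%R; lra.
have cl z (eps : R) N : (0 < eps)%R -> exists2 k, (N <= k)%N &
     (`|fine (feature H (mu k) z) - fine (feature H m z)| <= eps)%R.
  move=> eps0; have [B HB] := bH z; rewrite featureE.
  have [k Nk hk] := portmanteau_continuous N ooF mu1 m1 cvO (cH z) HB eps0.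
  by exists k => //; rewrite featureE.
have sum_le j : \sum_(0 <= i <oo) (2 ^+ i.+1 * e (j + i)%N)%:E <= (16 * (half ^+ j) ^+ 2)%:E.
  have h4 : (0 <= 4 :> R)%R by [].
  apply: le_trans (half_sum j h4) _.
  by rewrite lee_fin le_eqVlt; apply/predU1l; ring.
have SE := strong_limit_energy c0 mH bH rH mufin mfin e0 muJ Hc cl 0%N.
have SF j := strong_limit_features c0 mH bH rH mufin mfin e0 muJ Hc cl j.
have Jm : J m m < +oo.
  apply: le_lt_trans SE _; apply: lte_add_pinfty; first by rewrite lte_mul_pinfty ?lee_fin.
  by rewrite lte_mul_pinfty ?lee_fin//; apply: le_lt_trans (sum_le _) (ltry _).
have strong j : J (mu j) (mu j) + J m m <= 2%:E * J (mu j) m + (16 * (half ^+ j) ^+ 2)%:E.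
  by apply: le_trans (SF j) _; rewrite leeD2l.
exists m, F; split => //; split => //.
have mT : m.-negligible (~` setT) by rewrite setCT; exact: negligible_set0.
have [smu [smuE smum]] := Eplus_of alpha_lt mfin Jm mT.
have /EplusP[_ smu_pos _] := smuE.
suff /EplusP[_ _] : Eplus A smu by rewrite smum.
apply: closedA; first by have [] := smuE.
move=> eps eps0; have eps4 : (0 < eps / 4)%R by rewrite divr_gt0.
have [N /(_ N (leqnn N)) hN] := half_small eps4.
have [nu [nuA nuE]] := Eplus_of alpha_lt (mufin N) (muJ N) (muN N).
have /EplusP[_ nu_pos _] := nuA.
have [delta [dE dfin den]] := difference_exists alpha_lt mfin (mufin N) Jm (muJ N).
exists nu, delta; split => //.
  move=> B mB _; rewrite dE// /signed_value smum nuE.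
  by rewrite (smu_pos _ mB) (nu_pos _ mB) !sube0.
(* [16 * (half ^+ N) ^+ 2 < eps ^+ 2] by the choice of [N] *)
rewrite /strong_norm den.
move: (strong N); rewrite (rformC _ m (mu N)).
have JNm := rform_fin alpha_lt (muJ N) Jm.
rewrite -(fineK JNm) -(fineK (rform_fin alpha_lt Jm Jm)) -(fineK (rform_fin alpha_lt (muJ N) (muJ N))).
rewrite -!EFinM -!EFinD lee_fin /= => sN.
rewrite -[ltRHS]ger0_norm ?(ltW eps0)// -sqrtr_sqr.
rewrite ltr_sqrt ?exprn_gt0//.
have /andP[h0 _] := h01 N.
have : ((half ^+ N) ^+ 2 < (eps / 4) ^+ 2)%R by rewrite ltrXn2r// nnegrE ltW.
by rewrite expr_div_n; lra.
Qed.

End limit_of_cauchy_sequence.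

(** * Existence of a minimizer for an affine perturbation of the energy *)

(** The external field enters only through three properties of [L]: it is
affine at midpoints, the functional is bounded below, and [L] does not drop
along a sequence converging both weakly and strongly. *)
Section variational.
Context {R : realType} {n : nat} (alpha : R) (alpha_lt : alpha < n%:R) (A : set 'rV[R]_n).
Hypotheses (capA_gt0 : (0 < inner_capacity alpha A)%E)
  (capA_fin : (inner_capacity alpha A < +oo)%E)
  (closedA : strongly_closed (@Eplus R n alpha A)).
Notation X := (borel R n).
Notation sfm := {sigma_finite_measure set X -> \bar R}.
Local Open Scope ereal_scope.
Notation J := (rform alpha).
Notation half := (2^-1 : R)%R.
Notation adm := (admissible alpha A).

Lemma admissible_Eplus1 (mu : smeasure n alpha) : Eplus1 A mu -> adm (spos mu).
Proof.
by move=> [/EplusP[J_fin mu_pos mu_neg]]; rewrite signed_value_positive.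
Qed.

Lemma Eplus1_admissible (m : sfm) : adm m -> exists mu : smeasure n alpha, Eplus1 A mu /\ spos mu = m.
Proof.
move=> adm_m; have [m1 Jm mA] := adm_m.
have [mu [muA muE]] := Eplus_of alpha_lt (admissible_lty adm_m) Jm mA.
have /EplusP[_ mu_pos _] := muA.
by exists mu; split => //; split => //; rewrite signed_value_positive// muE.
Qed.

Lemma admissible_exists : exists m, adm m.
Proof.
have [_ [K [cK KA] <-] capK] := ereal_sup_gt capA_gt0.
have [[mu [/EplusP[J_fin mu_pos [B [mB B0 KB]]] mu1]]|noK] := pselect (exists mu, @Eplus1 R n alpha K mu).
  exists (spos mu); split => //; first by rewrite -signed_value_positive.
  by exists B; split => //; apply: subset_trans KB; exact: subsetC.
move: capK; rewrite /capacity (_ : [set energy mu | mu in _] = set0) ?ereal_inf0 ?invey ?ltxx//.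
by rewrite -subset0 => x [mu muK _]; apply: noK; exists mu.
Qed.

Variable L : sfm -> R.
Hypothesis L_mid : forall a b m : sfm, adm a -> adm b ->
  (forall B, measurable B -> m B = 2^-1%:E * a B + 2^-1%:E * b B) -> L m = ((L a + L b) / 2)%R.

(** The functional named after Gauss: energy in an external field, where [L m]
stands for the work of the field. *)
Definition gauss_functional m : R := (fine (J m m) - 2 * L m)%R.
Notation G := gauss_functional.

Lemma adm_fin a b : adm a -> adm b -> J a b \is a fin_num.
Proof. by move=> [_ Ja _] [_ Jb _]; exact: rform_fin. Qed.

(** The parallelogram law: the midpoint of [a] and [b] is admissible, so its
value is at least [w], and [L] cancels because it is affine. *)
Lemma near_minimizers a b (w x y : R) : (forall m, adm m -> (w <= G m)%R) ->
  adm a -> adm b -> (G a <= w + x)%R -> (G b <= w + y)%R ->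
  J a a + J b b <= 2%:E * J a b + (2 * (x + y))%:E.
Proof.
move=> wG adma admb Ga Gb.
have h2 : (0 <= 2^-1 :> R)%R by rewrite invr_ge0.
have [a1 Ja aA] := adma; have [b1 Jb bA] := admb.
have [p pE] := scale_exists h2 (admissible_lty adma).
have [q qE] := scale_exists h2 (admissible_lty admb).
have pfin : p setT < +oo by rewrite pE a1 mule1 ltry.
have qfin : q setT < +oo by rewrite qE b1 mule1 ltry.
have [m mE] := sum_exists pfin qfin.
have mE' B : measurable B -> m B = 2^-1%:E * a B + 2^-1%:E * b B.
  by move=> _; rewrite mE pE qE.
have mED B : measurable B -> m B = p B + q B by move=> _; exact: mE.
have pED B : measurable B -> p B = 2^-1%:E * a B by move=> _; exact: pE.
have qED B : measurable B -> q B = 2^-1%:E * b B by move=> _; exact: qE.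
have Jm : J m m = ((fine (J a a) + 2 * fine (J a b) + fine (J b b)) / 4)%:E.
  rewrite (rformDl _ _ mED) !(rformDr _ _ mED).
  rewrite !(rformZl _ _ h2 pED) !(rformZl _ _ h2 qED) !(rformZr _ _ h2 pED) !(rformZr _ _ h2 qED).
  rewrite (rformC _ b a) -(fineK (adm_fin adma adma)) -(fineK (adm_fin adma admb)) -(fineK (adm_fin admb admb)).
  by rewrite -!EFinM -!EFinD /=; congr (_%:E); field.
have admm : adm m.
  split.
  - by rewrite mE pE qE a1 b1 !mule1 -EFinD; congr (_%:E); field.
  - by rewrite Jm ltry.
  - have [Ba [mBa Ba0 ABa]] := aA; have [Bb [mBb Bb0 ABb]] := bA.
    exists (Ba `&` Bb); split; first exact: measurableI.
      have mBab : measurable (Ba `&` Bb) by exact: measurableI.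
      suff h0 : m (Ba `&` Bb) <= 0 by apply/eqP; rewrite eq_le measure_ge0 andbT; exact: h0.
      rewrite mE'//.
      apply: (@le_trans _ _ (2^-1%:E * a Ba + 2^-1%:E * b Bb)); last first.
        by rewrite Ba0 Bb0 !mule0 adde0.
      by apply: leeD; apply: lee_wpmul2l; rewrite ?lee_fin//; apply: le_measure;
        rewrite ?inE//; first [exact: measurableI|exact: subIsetl|exact: subIsetr].
    by rewrite subsetI.
have := wG m admm; rewrite /G Jm (L_mid adma admb mE') /=; move: Ga Gb; rewrite /G.
rewrite -(fineK (adm_fin adma adma)) -(fineK (adm_fin adma admb)) -(fineK (adm_fin admb admb)).
by rewrite -!EFinM -!EFinD lee_fin /=; lra.
Qed.

Hypothesis L_lb : exists c, forall m, adm m -> (c <= G m)%R.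

Hypothesis L_usc : forall (mu : nat -> sfm) (m : sfm) (F : set_system nat),
  ProperFilter F -> \oo `<=` F -> (forall k, adm (mu k)) -> adm m ->
  (forall (O : set 'rV[R]_n) (r : R), open O -> r%:E < m O -> F [set k | r%:E < mu k O]) ->
  (forall j, J (mu j) (mu j) + J m m <= 2%:E * J (mu j) m + (16 * (half ^+ j) ^+ 2)%:E) ->
  forall (eps : R) N, (0 < eps)%R -> exists2 j, (N <= j)%N & (L (mu j) <= L m + eps)%R.

Lemma gauss_minimizer : exists2 m, adm m & forall m', adm m' -> (G m <= G m')%R.
Proof.
have [m0 adm0] := admissible_exists; have [c cG] := L_lb.
pose S := [set G m | m in [set m | adm m]].
have S0 : S !=set0 by exists (G m0), m0.
have infS : has_inf S by split => //; exists c => _ [m am <-]; exact: cG.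
pose w := inf S.
have wG m : adm m -> (w <= G m)%R by move=> am; apply: ge_inf; [exact: infS.2|exists m].
have near_w k : exists m, adm m /\ (G m <= w + (half ^+ k) ^+ 2)%R.
  have h0 : (0 < (half ^+ k) ^+ 2)%R by rewrite !exprn_gt0// invr_gt0.
  have [_ [m am <-] mw] := inf_adherent h0 infS.
  by exists m; split => //; exact: ltW.
have [mu mu_adm] := choice near_w.
have admu k : adm (mu k) by have [] := mu_adm k.
have muw k : (G (mu k) <= w + (half ^+ k) ^+ 2)%R by have [] := mu_adm k.
have [m [F [[FF ooF] am weak strong]]] := cauchy_limit alpha_lt capA_fin closedA admu
   (fun j k => near_minimizers wG (admu j) (admu k) (muw j) (muw k)).
exists m => // m' am'; apply: le_trans (wG _ am').
apply/ler_addgt0Pr => eps eps0.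
have [_ Jm _] := am; set s := fine (J m m).
have s0 : (0 <= s)%R by rewrite fine_ge0// rform_ge0.
have d0 : (0 < eps / (4 * (17 + s)))%R by rewrite divr_gt0// mulr_gt0// ltr_wpDr.
have [N HN] := half_small d0.
have eps4 : (0 < eps / 4)%R by rewrite divr_gt0.
have [j Nj hL] := L_usc FF ooF admu am weak strong N eps4.
have [_ Jj _] := admu j.
have h0 : (0 < half ^+ j)%R by rewrite exprn_gt0// invr_gt0.
have h1 : (half ^+ j <= 1)%R by rewrite exprn_ile1//; lra.
(* [J m m <= J (mu j) (mu j) + 2 * (J m m - J (mu j) m)] by [rform_amgm], and the
   bracket is small by continuity in direction [m] itself *)
have := rform_continuity alpha_lt h0 Jj Jm Jm (strong j).
have := rform_amgm alpha_lt (mu j) m; have := muw j; have := HN j Nj.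
rewrite /G -/s; set h := (half ^+ j)%R in h0 h1 *.
rewrite -(fineK (adm_fin (admu j) (admu j))) -(fineK (adm_fin (admu j) am)) -(fineK (adm_fin am am)) -/s.
rewrite -!EFinM -!EFinD lee_fin /= => hN hw amgm.
have -> : (16 * h ^+ 2 / (2 * h) = 8 * h)%R by field; rewrite gt_eqF.
rewrite ler_distl => /andP[hc _].
move: hN; rewrite ltr_pdivlMr ?mulr_gt0 ?ltr_wpDr// => hN.
have hh : (h ^+ 2 <= h)%R by rewrite expr2 ger_pMl.
by nra.
Qed.

End variational.

(** * The work of the external field *)

Section external_field.
Context {R : realType} {n : nat} (alpha : R) (alpha_lt : alpha < n%:R) (A : set 'rV[R]_n).
Notation X := (borel R n).
Notation sfm := {sigma_finite_measure set X -> \bar R}.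
Local Open Scope ereal_scope.
Notation J := (rform alpha).
Notation half := (2^-1 : R)%R.
Notation adm := (admissible alpha A).
Variable omega : smeasure n alpha.
Notation p := (spos omega).
Notation q := (sneg omega).

(** The integral of the potential of [omega] against [m], split so that both
terms are energies of positive measures. *)
Definition field_work (m : sfm) : R := (fine (J m p) - fine (J m q))%R.

Lemma potentialE x : potential omega x = rpot alpha p x - rpot alpha q x.
Proof. by rewrite !rpotE. Qed.

Lemma abs_potentialE x : abs_potential omega x = rpot alpha p x + rpot alpha q x.
Proof.
rewrite /abs_potential !rpotE ge0_integral_measure_add//.
  by move=> y _; exact: riesz_kernel_ge0.
have mg : measurable_fun setT (fun y : X => ((x, y) : X * X)) by exact: measurable_fun_pair.
exact: (measurableT_comp (@riesz_kernel_borel R n alpha) mg).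
Qed.

Lemma integral_cst_mass1 (m : sfm) (r : R) : m setT = 1 -> \int[m]_x r%:E = r%:E.
Proof. by move=> m1; rewrite integral_cst// [X in _ * X]m1 mule1. Qed.

Lemma rpot_integrable (m m' : sfm) : J m m' < +oo -> m.-integrable setT (rpot alpha m').
Proof.
move=> Jmm'; apply/integrableP; split; first exact: rpot_borel.
by under eq_integral do rewrite gee0_abs ?rpot_ge0//; rewrite -rform_rpot.
Qed.

(** The potentials of [spos omega] and [sneg omega] are integrable, so the
integral of their difference may be split, although the difference itself may
be infinite at some points. *)
Lemma weighted_energyE (mu : smeasure n alpha) : positive_measure mu -> adm (spos mu) ->
  J (spos mu) p < +oo -> J (spos mu) q < +oo ->
  weighted_energy (fun x => - potential omega x) mu =
    (gauss_functional alpha field_work (spos mu))%:E.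
Proof.
move=> mu_pos [_ Jmu _] Jp Jq.
have ip := rpot_integrable Jp; have iq := rpot_integrable Jq.
rewrite /weighted_energy energy_positive// /integral_signed.
have -> : \int[sneg mu]_x - potential omega x = 0.
  rewrite (eq_measure_integral mzero) ?integral_measure_zero// => B mB _.
  exact: mu_pos.
rewrite sube0.
have -> : \int[spos mu]_x - potential omega x = - (J (spos mu) p - J (spos mu) q).
  rewrite !rform_rpot -integralB//.
  transitivity (\int[spos mu]_x - (rpot alpha p x - rpot alpha q x)).
    by apply: eq_integral => x _; rewrite potentialE.
  have iB := integrableB measurableT ip iq.
  by apply: integralN; exact: (integrable_add_def measurableT iB).
rewrite /gauss_functional /field_work.
rewrite -{1}(fineK (rform_fin alpha_lt Jmu Jmu)).
have Jpf : J (spos mu) p \is a fin_num by rewrite ge0_fin_numE ?rform_ge0.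
have Jqf : J (spos mu) q \is a fin_num by rewrite ge0_fin_numE ?rform_ge0.
rewrite -{1}(fineK Jpf) -{1}(fineK Jqf).
by rewrite /adde/mule/=; congr (_%:E); ring.
Qed.

Lemma field_work_mid (a b m : sfm) : adm a -> adm b ->
  J a p < +oo -> J a q < +oo -> J b p < +oo -> J b q < +oo ->
  (forall B, measurable B -> m B = 2^-1%:E * a B + 2^-1%:E * b B) ->
  field_work m = ((field_work a + field_work b) / 2)%R.
Proof.
move=> adma admb Jap Jaq Jbp Jbq mE.
have h2 : (0 <= 2^-1 :> R)%R by rewrite invr_ge0.
have [a' aE] := scale_exists h2 (admissible_lty adma).
have [b' bE] := scale_exists h2 (admissible_lty admb).
have mED B : measurable B -> m B = a' B + b' B by move=> mB; rewrite mE// aE bE.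
have aED B : measurable B -> a' B = 2^-1%:E * a B by move=> _; exact: aE.
have bED B : measurable B -> b' B = 2^-1%:E * b B by move=> _; exact: bE.
have fin (c d : sfm) : J c d < +oo -> J c d \is a fin_num.
  by rewrite ge0_fin_numE ?rform_ge0.
have mid (c : sfm) : J a c < +oo -> J b c < +oo ->
    (fine (J m c) = (fine (J a c) + fine (J b c)) / 2)%R.
  move=> Jac Jbc; rewrite (rformDl _ _ mED) (rformZl _ _ h2 aED) (rformZl _ _ h2 bED).
  by rewrite -(fineK (fin _ _ Jac)) -(fineK (fin _ _ Jbc)) /=; field.
by rewrite /field_work !mid//; field.
Qed.

Section finite_energy_field.
Hypothesis omega_fin : finite_energy omega.

(** An energy that is finite as a difference has a finite minuend. *)
Lemma finite_energy_parts : J p p < +oo /\ J q q < +oo.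
Proof.
move: omega_fin; rewrite /finite_energy energyE.
move: (rform_ge0 alpha p p) (rform_ge0 alpha q q) (rform_ge0 alpha p q) (rform_ge0 alpha q p).
case: (J p p) => [a| |]//; case: (J q q) => [b| |]//; case: (J p q) => [c| |]//;
  case: (J q p) => [d| |]//= *; by rewrite ?ltry.
Qed.

(** Completing the square with the positive part of [omega]; the negative part
only raises the functional. *)
Lemma field_work_lower_energy m : adm m ->
  (- fine (J p p) <= gauss_functional alpha field_work m)%R.
Proof.
move=> [_ Jm _]; have [Jp Jq] := finite_energy_parts.
have := rform_amgm alpha_lt m p.
rewrite -(fineK (rform_fin alpha_lt Jm Jp)) -(fineK (rform_fin alpha_lt Jm Jm)).
rewrite -(fineK (rform_fin alpha_lt Jp Jp)) -EFinM -EFinD lee_fin /gauss_functional /field_work.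
by have := fine_ge0 (rform_ge0 alpha m q); rewrite /=; lra.
Qed.

(** Strong continuity of the energy form against [spos omega] and
[sneg omega]; with [t] equal to [half ^+ j] the error is of order
[half ^+ j]. *)
Lemma field_work_continuous (mu : nat -> sfm) (m : sfm) :
  (forall k, adm (mu k)) -> adm m ->
  (forall j, J (mu j) (mu j) + J m m <= 2%:E * J (mu j) m + (16 * (half ^+ j) ^+ 2)%:E) ->
  forall (eps : R) N, (0 < eps)%R ->
    exists2 j, (N <= j)%N & (field_work (mu j) <= field_work m + eps)%R.
Proof.
move=> admu [_ Jm _] strong eps N eps0; have [Jp Jq] := finite_energy_parts.
set sp := fine (J p p); set sq := fine (J q q).
have sp0 : (0 <= sp)%R by rewrite fine_ge0// rform_ge0.
have sq0 : (0 <= sq)%R by rewrite fine_ge0// rform_ge0.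
have d0 : (0 < eps / (16 + sp + sq))%R by rewrite divr_gt0// !ltr_wpDr.
have [N' HN] := half_small d0.
exists (maxn N N'); first exact: leq_maxl.
set j := maxn N N'; have hj := HN j (leq_maxr _ _).
have [_ Jj _] := admu j.
have h0 : (0 < half ^+ j)%R by rewrite exprn_gt0// invr_gt0.
have := rform_continuity alpha_lt h0 Jj Jm Jp (strong j).
have := rform_continuity alpha_lt h0 Jj Jm Jq (strong j).
move: hj; rewrite -/sp -/sq; set h := (half ^+ j)%R in h0 *.
have -> : (16 * h ^+ 2 / (2 * h) = 8 * h)%R by field; rewrite gt_eqF.
rewrite ltr_pdivlMr ?ltr_wpDr// !ler_distl => hN /andP[hq _] /andP[_ hp].
by rewrite /field_work; nra.
Qed.

End finite_energy_field.

Section bounded_field.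
Variable M : R.
Hypotheses (M0 : (0 <= M)%R) (abs_le : forall x, A x -> abs_potential omega x <= M%:E).

Lemma field_energy_le (m c : sfm) : adm m ->
  (forall x, A x -> rpot alpha c x <= M%:E) -> J m c <= M%:E.
Proof.
move=> [m1 _ mA] cM; rewrite rform_rpot.
rewrite -(integral_cst_mass1 M m1).
apply: ae_ge0_le_integral => //.
- by move=> x _; exact: rpot_ge0.
- exact: rpot_borel.
have [N [mN N0 AN]] := mA; exists N; split => // x /= h; apply: AN => Ax; apply: h => _.
exact: cM.
Qed.

Lemma pos_potential_le x : A x -> rpot alpha p x <= M%:E.
Proof. by move=> /abs_le; rewrite abs_potentialE; apply: le_trans; rewrite leeDl// rpot_ge0. Qed.

Lemma neg_potential_le x : A x -> rpot alpha q x <= M%:E.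
Proof. by move=> /abs_le; rewrite abs_potentialE; apply: le_trans; rewrite leeDr// rpot_ge0. Qed.

Lemma field_work_lower_bounded m : adm m ->
  (- (2 * M) <= gauss_functional alpha field_work m)%R.
Proof.
move=> am; have := field_energy_le am pos_potential_le.
have := rform_ge0 alpha m q; have := rform_ge0 alpha m p; have := rform_ge0 alpha m m.
rewrite /gauss_functional /field_work.
move=> /fine_ge0 h1; case: (J m p) => [x| |]// hx /fine_ge0 h2.
rewrite lee_fin => h3 /=; lra.
Qed.

(** [M - y] cut off to the interval from [0] to [2 * M]. The values of the
potential on [A] lie between [- M] and [M], where nothing is cut off. *)
Definition truncation (y : \bar R) : R :=
  match y with
  | r%:E => Num.max 0%R (Num.min (2 * M)%R (M - r)%R)
  | +oo => 0%R
  | -oo => (2 * M)%R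
  end.

Lemma truncation_bounds y : (0 <= truncation y <= 2 * M)%R.
Proof.
have M2 : (0 <= 2 * M)%R by rewrite mulr_ge0.
case: y => [r| |] /=; rewrite ?lexx ?M2//.
by rewrite le_max lexx/= ge_max M2 ge_min lexx.
Qed.

Lemma truncation_gt (a : R) y : (0 <= a < 2 * M)%R ->
  (a < truncation y)%R = (y < (M - a)%:E).
Proof.
move=> /andP[a0 aM]; case: y => [r| |] /=.
- by rewrite lt_max ltNge a0/= lt_min aM/= lte_fin ltrBrDr ltrBrDr addrC.
- by rewrite ltNge a0.
- by rewrite aM ltNyr.
Qed.

Hypothesis omega_usc : upper_semicontinuous_on (closure A) (potential omega).

(** Off the closure of [A] the largest possible value is taken, which keeps
the function lower semicontinuous at the boundary of the closure. *)
Definition cut_off (x : 'rV[R]_n) : R :=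
  if `[< closure A x >] then truncation (potential omega x) else (2 * M)%R.

Lemma cut_off_bounds x : (0 <= cut_off x <= 2 * M)%R.
Proof.
rewrite /cut_off; case: ifP => _; first exact: truncation_bounds.
by rewrite mulr_ge0//= lexx.
Qed.

(** Only levels [a] between [0] and [2 * M] matter. The condition defining the
superlevel set constrains nothing near a point off the closure of [A], and is
stable near a point of the closure by upper semicontinuity. *)
Lemma cut_off_lsc (a : R) : open [set x | (a < cut_off x)%R].
Proof.
have [a0|a0] := ltP a 0%R.
  rewrite (_ : [set _ | _] = setT); first exact: openT.
  by apply/seteqP; split => // x _ /=; have /andP[h _] := cut_off_bounds x; exact: lt_le_trans h.
have [aM|aM] := leP (2 * M)%R a.
  rewrite (_ : [set _ | _] = set0); first exact: open0.
  apply/seteqP; split => // x /=; have /andP[_ h] := cut_off_bounds x.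
  by rewrite ltNge (le_trans h aM).
rewrite (_ : [set _ | _] = [set x | closure A x -> potential omega x < (M - a)%:E]).
  rewrite openE => x /= hx; have [cx|ncx] := pselect (closure A x).
    by apply: filterS (omega_usc cx (hx cx)) => y.
  have : nbhs x (~` closure A).
    by apply: open_nbhs_nbhs; split => //; apply: closed_openC; exact: closed_closure.
  by apply: filterS => y ny /ny.
apply/seteqP; split => x /=; rewrite /cut_off; case: asboolP => [cx|ncx] //.
  by rewrite truncation_gt ?a0.
by rewrite truncation_gt ?a0//; apply.
Qed.

(** On [A], hence almost everywhere, [cut_off] is [M] minus the potential. The
identity is integrated in the additive form
[cut_off + U^omega+ = M + U^omega-], in which all terms are nonnegative. *)
Lemma cut_off_integral m : adm m -> \int[m]_x (cut_off x)%:E = (M - field_work m)%:E.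
Proof.
move=> am; have [m1 _ [N [mN N0 AN]]] := am.
have mg : measurable_fun setT (cut_off : X -> R) by exact: lsc_borel cut_off_lsc.
have mgE : measurable_fun setT (fun x : X => (cut_off x)%:E) by exact/measurable_EFinP.
have g0 x : 0 <= (cut_off x)%:E by rewrite lee_fin; have /andP[] := cut_off_bounds x.
have E : \int[m]_x (cut_off x)%:E + J m p = M%:E + J m q.
  rewrite !rform_rpot -[in RHS](integral_cst_mass1 M m1).
  have r0 (c : sfm) (x : X) : setT x -> 0 <= rpot alpha c x by move=> _; exact: rpot_ge0.
  have rm (c : sfm) : measurable_fun setT (rpot alpha c : X -> \bar R) by exact: rpot_borel.
  rewrite -!ge0_integralD//; try by move=> x; exact: r0.
  apply: ge0_ae_eq_integral => //.
  - by apply: emeasurable_funD => //; exact: rpot_borel.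
  - by apply: emeasurable_funD => //; exact: rpot_borel.
  - by move=> x _; rewrite adde_ge0// rpot_ge0.
  - by move=> x _; rewrite adde_ge0// rpot_ge0.
  exists N; split => // x /= h; apply: AN => Ax; apply: h => _.
  rewrite /cut_off; case: asboolP => [_|nc]; last by exfalso; apply: nc; exact: subset_closure.
  rewrite potentialE; have := abs_le Ax; rewrite abs_potentialE.
  have := rpot_ge0 alpha p x; have := rpot_ge0 alpha q x.
  case: (rpot alpha p x) => [s| |]//; case: (rpot alpha q x) => [t| |]//.
  rewrite -EFinD !lee_fin => t0 s0 st /=; rewrite -!EFinD; congr (_%:E).
  have -> : Num.min (2 * M)%R (M - (s - t))%R = (M - (s - t))%R by apply: min_r; lra.
  have -> : Num.max 0%R (M - (s - t))%R = (M - (s - t))%R by apply: max_r; lra.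
  by ring.
move: E; rewrite /field_work.
have := field_energy_le am pos_potential_le; have := field_energy_le am neg_potential_le.
have := rform_ge0 alpha m p; have := rform_ge0 alpha m q.
case: (J m p) => [s| |]//; case: (J m q) => [t| |]// _ _ _ _.
case: (\int[m]_x _) => [u| |]//=; rewrite -!EFinD => -[] h; congr (_%:E); lra.
Qed.

Lemma field_work_usc (mu : nat -> sfm) (m : sfm) (F : set_system nat) :
  ProperFilter F -> \oo `<=` F -> (forall k, adm (mu k)) -> adm m ->
  (forall (O : set 'rV[R]_n) (r : R), open O -> r%:E < m O -> F [set k | r%:E < mu k O]) ->
  forall (eps : R) N, (0 < eps)%R ->
    exists2 j, (N <= j)%N & (field_work (mu j) <= field_work m + eps)%R.
Proof.
move=> FF ooF admu am weak eps N eps0.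
have mu1 k : mu k setT = 1 by have [] := admu k.
have m1 : m setT = 1 by have [] := am.
have h := @portmanteau_lsc _ _ mu m F _ cut_off (2 * M)%R mu1 m1 weak cut_off_lsc cut_off_bounds
  (M - field_work m - eps)%R.
have F1 : F [set k | (M - field_work m - eps)%:E < \int[mu k]_x (cut_off x)%:E].
  by apply: h; rewrite cut_off_integral// lte_fin; lra.
have F2 : F [set k | (N <= k)%N] by apply: ooF; exists N.
have [k [/= k1 k2]] := filter_ex (filterI F1 F2).
by exists k => //; move: k1; rewrite cut_off_integral// lte_fin; lra.
Qed.

End bounded_field.

End external_field.

(** * Existence of the weighted equilibrium measure *)

Theorem theorem6p1 (R : realType) (n : nat) (alpha : R)
  (n_ge2 : (2 <= n)%N) (alpha_gt0 : 0 < alpha) (alpha_ltn : alpha < n%:R)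
  (A : set 'rV[R]_n)
  (capA_gt0 : (0 < inner_capacity alpha A)%E)
  (closedA : strongly_closed (@Eplus R n alpha A))
  (omega : smeasure n alpha)
  (Homega : finite_energy omega \/
    [/\ (spos omega setT < +oo)%E,
        upper_semicontinuous_on (closure A) (potential omega) &
        (ereal_sup [set abs_potential omega x | x in A] < +oo)%E])
  (capA_fin : (inner_capacity alpha A < +oo)%E) :
  let f := fun x : 'rV[R]_n => (- potential omega x)%E in
  exists lambda : smeasure n alpha,
    Eplus1 A lambda /\
    forall mu : smeasure n alpha, Eplus1 A mu ->
      (weighted_energy f lambda <= weighted_energy f mu)%E.
Proof.
move=> f.
pose L := field_work omega.
have [work_fin [c c_lb] L_usc] : [/\
    forall m, admissible alpha A m ->
      (rform alpha m (spos omega) < +oo)%E /\ (rform alpha m (sneg omega) < +oo)%E,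
    exists c, forall m, admissible alpha A m -> c <= gauss_functional alpha L m &
    forall mu m F, ProperFilter F -> \oo `<=` F ->
      (forall k, admissible alpha A (mu k)) -> admissible alpha A m ->
      (forall (O : set 'rV[R]_n) (r : R), open O -> (r%:E < m O)%E ->
         F [set k | (r%:E < mu k O)%E]) ->
      (forall j, rform alpha (mu j) (mu j) + rform alpha m m <=
         2%:E * rform alpha (mu j) m + (16 * (2^-1 ^+ j) ^+ 2)%:E)%E ->
      forall eps N, 0 < eps -> exists2 j, (N <= j)%N & L (mu j) <= L m + eps].
  case: Homega => [omega_fin|[_ omega_usc omega_bnd]].
    have [Jp Jq] := finite_energy_parts omega_fin; split.
    - by move=> m [_ Jm _]; split; exact: rform_lty.
    - by exists (- fine (rform alpha (spos omega) (spos omega))) => m; exact: field_work_lower_energy.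
    - by move=> mu m F _ _ admu am _; exact: field_work_continuous.
  have [M M0 HM] : exists2 M : R, 0 <= M & forall x, A x -> (abs_potential omega x <= M%:E)%E.
    move: omega_bnd; set S := ereal_sup _ => Soo.
    have SA x : A x -> (abs_potential omega x <= S)%E.
      by move=> Ax; apply: ereal_sup_ubound; exists x.
    exists (Num.max 0 (fine S)); first by rewrite le_max lexx.
    move=> x /SA /le_trans; apply; move: Soo; case: S {SA} => [s _| |_]//=.
      by rewrite lee_fin le_max lexx orbT.
    by rewrite leNye.
  split.
  - move=> m am; split; apply: le_lt_trans (ltry M).
      exact: (field_energy_le M0 am (pos_potential_le HM)).
    exact: (field_energy_le M0 am (neg_potential_le HM)).
  - by exists (- (2 * M)) => m; exact: field_work_lower_bounded.
  - by move=> mu m F FF ooF admu am weak _; exact: (field_work_usc M0 HM omega_usc FF ooF admu am weak).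
have L_mid (a b m : {sigma_finite_measure set (borel R n) -> \bar R}) :
    admissible alpha A a -> admissible alpha A b ->
    (forall B, measurable B -> m B = 2^-1%:E * a B + 2^-1%:E * b B)%E ->
    L m = (L a + L b) / 2.
  move=> adma admb; have [? ?] := work_fin _ adma; have [? ?] := work_fin _ admb.
  exact: (field_work_mid adma admb).
have [m am m_min] := gauss_minimizer alpha_ltn capA_gt0 capA_fin closedA L_mid
  (ex_intro _ c c_lb) L_usc.
have [lambda [lambdaA lambdaE]] := Eplus1_admissible alpha_ltn am.
have value (mu : smeasure n alpha) : Eplus1 A mu -> weighted_energy f mu = (gauss_functional alpha L (spos mu))%:E.
  move=> muA; have amu := admissible_Eplus1 muA; have [? ?] := work_fin _ amu.
  by apply: (weighted_energyE alpha_ltn) amu _ _ => //; have [/EplusP[]] := muA.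
exists lambda; split => // mu muA; rewrite !value// lambdaE lee_fin.
by apply: m_min; exact: admissible_Eplus1.
Qed.
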